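(* Let $(\omega(t),g(t))$ be a left-invariant $(p,q)$-flow solution on a Lie group of dimension $2n$, with maximal interval of existence $(T_-,T_+)$, $T_-<0<T_+$. If the solution has a finite-time singularity at $T_+$, i.e. $T_+<\infty$ (resp. at $T_-$, i.e. $T_->-\infty$), then $$\int_0^{T_+}|P+Q^{ac}|\,dt=\infty\qquad\left(\text{resp. }\int_{T_-}^{0}|P+Q^{ac}|\,dt=\infty\right),$$ where $P=P(\omega(t),g(t))$, $Q=Q(\omega(t),g(t))$.
   Context: Almost-hermitian structures. On a real vector space $\mathfrak g$ of dimension $2n$, an almost-hermitian structure is a pair $(\omega,g)$, with $\omega$ a non-degenerate $2$-form and $g$ an inner product, such that the operator $J$ defined by $\omega=g(J\cdot,\cdot)$ satisfies $J^2=-I$. Left-invariant almost-hermitian structures on a Lie group are identified with almost-hermitian structures on its Lie algebra. For $A\in\mathrm{End}(\mathfrak g)$: $A^{c}:=\frac12(A-JAJ)$, $A^{ac}:=\frac12(A+JAJ)$. The pair $(p,q)$. One fixes a rule assigning to every almost-hermitian structure $(\omega,g)$ on every $2n$-dimensional real Lie algebra $\mathfrak g$ a $2$-form $p=p(\omega,g)\in\Lambda^2\mathfrak g^*$ and a symmetric bilinear form $q=q(\omega,g)\in S^2\mathfrak g^*$. Operators $P,Q\in\mathrm{End}(\mathfrak g)$ are defined by $p=\omega(P\cdot,\cdot)$, $q=g(Q\cdot,\cdot)$. Standing assumptions: (a) invariance: if $\varphi$ is a Lie algebra isomorphism carrying $(\omega_1,g_1)$ to $(\omega_2,g_2)$,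 i.e. $\omega_1=\omega_2(\varphi\cdot,\varphi\cdot)$ and $g_1=g_2(\varphi\cdot,\varphi\cdot)$, then $P(\omega_2,g_2)=\varphi P(\omega_1,g_1)\varphi^{-1}$ and $Q(\omega_2,g_2)=\varphi Q(\omega_1,g_1)\varphi^{-1}$; (b) compatibility: $P^c=Q^c$ for every almost-hermitian structure; (c) regularity: for fixed $(\omega_0,g_0)$ on the vector space $\mathfrak g$, the operators $P_\mu,Q_\mu$ associated to $(\omega_0,g_0)$ on the Lie algebra $(\mathfrak g,\mu)$ depend smoothly on the Lie bracket $\mu$ (they are restrictions of smooth maps defined on a neighbourhood of the set of Lie brackets in $\Lambda^2\mathfrak g^*\otimes\mathfrak g$); (d) scaling invariance: $p(c\omega,cg)=p(\omega,g)$ and $q(c\omega,cg)=q(\omega,g)$ for all $c>0$. Flow. A left-invariant $(p,q)$-flow solution is a solution of the ODE $\frac{d}{dt}\omega=-2p(\omega,g)$, $\frac{d}{dt}g=-2q(\omega,g)$ for almost-hermitian structures $(\omega(t),g(t))$ on the (fixed) Lie algebra of the group. At each time $t$, $Q^{ac}$ is taken with respect to $J(t)$ and $|\cdot|$ is the norm on $\mathrm{End}(\mathfrak g)$ induced by $g(t)$, i.e. $|A|^2=\mathrm{tr}(AA^{t})$ with the transpose relative to $g(t)$. *)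

(* Defs.v *)
From HB Require Import structures.
From mathcomp Require Import all_boot all_order all_algebra.
From mathcomp Require Import all_classical all_reals all_analysis.
Set Implicit Arguments.
Unset Strict Implicit.
Unset Printing Implicit Defensive.
Import Order.TTheory GRing.Theory Num.Theory.
Import numFieldNormedType.Exports.
Local Open Scope classical_set_scope.
Local Open Scope ring_scope.

Notation bimap V W := ('Hom(V, 'Hom(V, W))) (only parsing).
Notation bilform R V := ('Hom(V, 'Hom(V, R^o))) (only parsing).

Section Bilinear.
Variable R : realType.
Implicit Types V W : vectType R.

Definition slot2 V W (B : bimap V W) (x y : V) : W := B y x.
Definition flip V W (B : bimap V W) : bimap V W :=
  linfun (fun x => linfun (slot2 B x)).
Definition symmetrize V W (B : bimap V W) : bimap V W :=
  B + flip B.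

(* The space of W-valued 2-forms on V, i.e. Lambda^2 V^* (x) W; see alt2P. *)
Definition alt2 V W : {vspace bimap V W} :=
  lker (linfun (@symmetrize V W)).

Definition symmetric_form V (B : bilform R V) : Prop :=
  forall x y, B x y = B y x.

Definition nondegenerate V (B : bilform R V) : Prop :=
  forall x, (forall y, B x y = 0) -> x = 0.

(* The operator A with b = B(A., .): seen as maps from V to its dual,
   b = B \o A.  Meaningful for nondegenerate B; see form_opE. *)
Definition form_op V (B b : bilform R V) : 'End(V) := (B^-1 \o b)%VF.

(* The transpose of A relative to g; see adjointE. *)
Definition adjoint V (g : bilform R V) (A : 'End(V)) : 'End(V) :=
  form_op g (linfun (fun y => (g y \o A)%VF)).

Definition lftrace V (A : 'End(V)) : R :=
  \tr (passmx.mxof (vbasis {:V}) (vbasis {:V}) A).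

Definition op_norm V (g : bilform R V) (A : 'End(V)) : R :=
  Num.sqrt (lftrace (A \o adjoint g A)%VF).

Lemma slot2_linear V W (B : bimap V W) x : linear (slot2 B x).
Proof. by move=> a u v; rewrite /slot2 linearP add_lfunE scale_lfunE. Qed.
HB.instance Definition _ V W (B : bimap V W) x :=
  GRing.isLinear.Build R V W _ (slot2 B x) (@slot2_linear V W B x).

Lemma flip_fun_linear V W (B : bimap V W) :
  linear (fun x => linfun (slot2 B x)).
Proof.
move=> a u v; apply/lfunP => y.
by rewrite add_lfunE scale_lfunE !lfunE /= /slot2 linearP.
Qed.

Lemma flipE V W (B : bimap V W) x y : flip B x y = B y x.
Proof.
pose f := fun x => linfun (slot2 B x).
pose H := GRing.isLinear.Build R _ _ _ f (@flip_fun_linear V W B).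
pose F : {linear V -> 'Hom(V, W)} := HB.pack f H.
by rewrite /flip (lfunE F) /= /f lfunE.
Qed.

Lemma symmetrize_linear V W : linear (@symmetrize V W).
Proof.
move=> a A B; apply/lfunP => x; apply/lfunP => y.
rewrite /symmetrize !(add_lfunE, scale_lfunE, flipE).
by rewrite scalerDr addrACA.
Qed.
HB.instance Definition _ V W := GRing.isLinear.Build R _ _ _
  (@symmetrize V W) (@symmetrize_linear V W).

Lemma alt2P V W (B : bimap V W) :
  (B \in alt2 V W) <-> (forall x, B x x = 0).
Proof.
rewrite memv_ker lfunE /=; split=> [/eqP B0 x | B0].
  have /lfunP/(_ x)/lfunP/(_ x) := B0.
  rewrite /symmetrize !add_lfunE flipE !zero_lfunE -mulr2n -scaler_nat.
  by move=> /eqP; rewrite scaler_eq0 pnatr_eq0 /= => /eqP.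
apply/eqP/lfunP => x; apply/lfunP => y.
rewrite /symmetrize !add_lfunE flipE !zero_lfunE.
have := B0 (x + y).
have -> : B (x + y) = B x + B y by rewrite linearD.
rewrite add_lfunE.
have -> : B x (x + y) = B x x + B x y by rewrite linearD.
have -> : B y (x + y) = B y x + B y y by rewrite linearD.
by rewrite !B0 add0r addr0.
Qed.

Lemma form_opE V (B b : bilform R V) : nondegenerate B ->
  forall x y, B (form_op B b x) y = b x y.
Proof.
move=> Bnd x y; rewrite /form_op comp_lfunE /=.
have kB : lker B = 0%VS.
  apply/eqP; rewrite -subv0; apply/subvP => u; rewrite memv_ker memv0 => /eqP Bu.
  by apply/eqP/Bnd => z; rewrite Bu zero_lfunE.
have iB : limg B = fullv.
  apply/eqP; rewrite -dimv_leqif_eq ?subvf//.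
  rewrite limg_dim_eq ?kB ?capv0// !dimvf /dim /=.
  by rewrite muln1.
by rewrite limg_lfunVK// iB memvf.
Qed.

Lemma adjointE V (g : bilform R V) (A : 'End(V)) :
  nondegenerate g -> forall x y, g (adjoint g A y) x = g y (A x).
Proof.
move=> gnd x y; rewrite /adjoint form_opE//.
pose f y := (g y \o A)%VF.
have lf : linear f.
  move=> a u v; apply/lfunP => z.
  by rewrite /f !(comp_lfunE, add_lfunE, scale_lfunE, linearP).
pose H := GRing.isLinear.Build R _ _ _ f lf.
pose F : {linear V -> 'Hom(V, R^o)} := HB.pack f H.
by rewrite (lfunE F) /= /f comp_lfunE.
Qed.

End Bilinear.

Section Smooth.
Variable R : realType.

(* f is of class C^k on the open set U; in finite dimension this is the usual
   notion, expressed with iterated directional derivatives. *)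
Fixpoint Ck_on (V W : normedModType R) (k : nat) (U : set V) (f : V -> W)
    : Prop :=
  (forall x, U x -> {for x, continuous f}) /\
  (if k is k'.+1 then
     forall v, (forall x, U x -> derivable f x v) /\
               Ck_on k' U (fun x => 'D_v f x)
   else True).

(* Abstract finite-dimensional spaces carry their canonical topology and smooth
   structure, read in the coordinates of a basis. *)
Definition of_coord (V : vectType R) (u : 'rV[R]_(\dim {:V})) : V :=
  passmx.vecof (vbasis {:V}) u.
Definition to_coord (V : vectType R) (v : V) : 'rV[R]_(\dim {:V}) :=
  passmx.rVof (vbasis {:V}) v.

Definition vect_open (V : vectType R) (U : set V) : Prop :=
  open (@of_coord V @^-1` U).

Definition smooth_on (V W : vectType R) (U : set V) (f : V -> W) : Prop :=
  forall k, Ck_on k (@of_coord V @^-1` U) (@to_coord W \o f \o @of_coord V).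

End Smooth.

Section AlmostHermitian.
Variable R : realType.
Implicit Types V : vectType R.

Record lie_bracket V (mu : bimap V V) : Prop := LieBracket {
  lie_alt : mu \in alt2 V V;
  lie_jacobi : forall x y z,
    mu x (mu y z) + mu y (mu z x) + mu z (mu x y) = 0 }.

Definition Jop V (w g : bilform R V) : 'End(V) := form_op g w.

Record almost_hermitian V (w g : bilform R V) : Prop :=
  AlmostHermitian {
    ah_alt : w \in alt2 V R^o;
    ah_nondeg : nondegenerate w;
    ah_sym : symmetric_form g;
    ah_pos : forall x, x != 0 -> (0 : R) < g x x;
    ah_J : (Jop w g \o Jop w g)%VF = - \1%VF }.

Definition cpart V (J A : 'End(V)) : 'End(V) :=
  (2 : R)^-1 *: (A - (J \o A \o J)%VF).
Definition acpart V (J A : 'End(V)) : 'End(V) :=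
  (2 : R)^-1 *: (A + (J \o A \o J)%VF).

(* The assignment is total: only its values at a Lie bracket and an
   almost-hermitian pair on a space of dimension 2n are ever used. *)
Record pq_rule := PQRule {
  rule_p : forall V, bimap V V ->
    bilform R V -> bilform R V -> bilform R V;
  rule_q : forall V, bimap V V ->
    bilform R V -> bilform R V -> bilform R V }.

Definition Pop (r : pq_rule) V (mu : bimap V V)
  (w g : bilform R V) : 'End(V) := form_op w (rule_p r mu w g).
Definition Qop (r : pq_rule) V (mu : bimap V V)
  (w g : bilform R V) : 'End(V) := form_op g (rule_q r mu w g).

Definition pq_typed (n : nat) (r : pq_rule) : Prop :=
  forall V (mu : bimap V V) (w g : bilform R V),
    \dim {:V} = (2 * n)%N -> lie_bracket mu -> almost_hermitian w g ->
    rule_p r mu w g \in alt2 V R^o /\ symmetric_form (rule_q r mu w g).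

Definition pq_invariant (n : nat) (r : pq_rule) : Prop :=
  forall V1 V2 (mu1 : bimap V1 V1) (mu2 : bimap V2 V2)
    (w1 g1 : bilform R V1) (w2 g2 : bilform R V2)
    (phi : 'Hom(V1, V2)),
    \dim {:V1} = (2 * n)%N -> \dim {:V2} = (2 * n)%N ->
    lie_bracket mu1 -> lie_bracket mu2 ->
    almost_hermitian w1 g1 -> almost_hermitian w2 g2 ->
    bijective phi ->
    (forall x y, phi (mu1 x y) = mu2 (phi x) (phi y)) ->
    (forall x y, w1 x y = w2 (phi x) (phi y)) ->
    (forall x y, g1 x y = g2 (phi x) (phi y)) ->
    Pop r mu2 w2 g2 = (phi \o Pop r mu1 w1 g1 \o phi^-1)%VF /\
    Qop r mu2 w2 g2 = (phi \o Qop r mu1 w1 g1 \o phi^-1)%VF.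

Definition pq_compatible (n : nat) (r : pq_rule) : Prop :=
  forall V (mu : bimap V V) (w g : bilform R V),
    \dim {:V} = (2 * n)%N -> lie_bracket mu -> almost_hermitian w g ->
    cpart (Jop w g) (Pop r mu w g) = cpart (Jop w g) (Qop r mu w g).

Definition pq_regular (n : nat) (r : pq_rule) : Prop :=
  forall V (w g : bilform R V),
    \dim {:V} = (2 * n)%N -> almost_hermitian w g ->
    exists (U : set (subvs_of (alt2 V V)))
           (FP FQ : subvs_of (alt2 V V) -> 'End(V)),
      [/\ vect_open U,
          (forall mu, lie_bracket (vsval mu) -> U mu),
          smooth_on U FP,
          smooth_on U FQ &
          forall mu, lie_bracket (vsval mu) ->
            FP mu = Pop r (vsval mu) w g /\ FQ mu = Qop r (vsval mu) w g].

Definition pq_scale_invariant (n : nat) (r : pq_rule) : Prop :=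
  forall V (mu : bimap V V) (w g : bilform R V) (c : R),
    \dim {:V} = (2 * n)%N -> lie_bracket mu -> almost_hermitian w g -> 0 < c ->
    rule_p r mu (c *: w) (c *: g) = rule_p r mu w g /\
    rule_q r mu (c *: w) (c *: g) = rule_q r mu w g.

Record pq_standing (n : nat) (r : pq_rule) : Prop := PQStanding {
  pq_ty : pq_typed n r;
  pq_inv : pq_invariant n r;
  pq_comp : pq_compatible n r;
  pq_reg : pq_regular n r;
  pq_scale : pq_scale_invariant n r }.

Definition eitv (a b : \bar R) : set R := [set t | (a < t%:E)%E /\ (t%:E < b)%E].

(* A curve of bilinear forms is differentiated entrywise.  The curves are total
   functions of time whose values outside ]a, b[ are irrelevant. *)
Definition flow_solution (r : pq_rule) V (mu : bimap V V)
    (w g : R -> bilform R V) (a b : \bar R) : Prop :=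
  forall t : R, eitv a b t ->
    [/\ almost_hermitian (w t) (g t),
        (forall x y, is_derive (t : R^o) (1 : R^o) (fun s => w s x y : R^o)
                       (- 2 * rule_p r mu (w t) (g t) x y)) &
        (forall x y, is_derive (t : R^o) (1 : R^o) (fun s => g s x y : R^o)
                       (- 2 * rule_q r mu (w t) (g t) x y))].

Definition maximal_flow_solution (r : pq_rule) V (mu : bimap V V)
    (w g : R -> bilform R V) (a b : \bar R) : Prop :=
  flow_solution r mu w g a b /\
  forall (w' g' : R -> bilform R V) (a' b' : \bar R),
    (a' <= a)%E -> (b <= b')%E -> flow_solution r mu w' g' a' b' ->
    (forall t, eitv a b t -> w' t = w t /\ g' t = g t) ->
    a' = a /\ b' = b.

Definition PQac_norm (r : pq_rule) V (mu : bimap V V)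
    (w g : bilform R V) : R :=
  op_norm g (Pop r mu w g + acpart (Jop w g) (Qop r mu w g)).

End AlmostHermitian.

(* Main.v *)
(** The operator A = P + Q^ac satisfies w(A x, y) + w(x, A y) = 2 p(x, y) and
    g(A x, y) + g(x, A y) = 2 q(x, y), so |p| and |q| are controlled by |A| in the
    moving metric.  If the integral of |A| up to a finite time T is finite, then by
    Gronwall the metrics g(t) stay uniformly equivalent, and (w(t), g(t)) converges
    to an almost-hermitian pair (wT, gT).  The flow can be restarted there: with A
    computed at the fixed pair (wT, gT) for the transported bracket
    m = h mu(h^-1 ., h^-1 .), it is the pullback of (wT, gT) by the solution of
    h' = - A_m h, an ODE whose field is locally Lipschitz by regularity.  Glued to
    the given solution at T this contradicts maximality.  Differentiability at T
    needs p and q to be continuous in (w, g): nearby almost-hermitian pairs differ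
    by an h close to the identity, so invariance reduces this to regularity in the
    bracket.  The past endpoint follows by time reversal, (p, q) |-> (-p, -q). *)

(* The obstacle is that the rule is controlled only along brackets: regularity fixes the pair and
   varies [mu], so as a function of (w, g) the right-hand side of the flow is not even known to be
   continuous. Analysis is therefore done at a frozen pair and moved by invariance. The continuity
   so obtained also makes |A| continuous in time, which its measurability and its primitive require.
   Smoothness enters only as a local Lipschitz bound. The identities for A rest on two readings of
   it: P^c = Q^c says that P + Q^ac = Q + P^ac. Since Q^ac is g-symmetric and anticommutes with J,
   it drops out of w(A x, y) + w(x, A y); since P^ac is g-skew, it drops out of g(A x, y) + g(x, A
   y). A finite integral is used through one consequence, a bounded primitive Phi of |A|; Gronwall
   and convergence at T become monotonicity of expressions in Phi. Uniqueness for the flow is never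
   invoked: any extension contradicts maximality. *)
Require Import Defs.
From HB Require Import structures.
From mathcomp Require Import all_boot all_order all_algebra.
From mathcomp Require Import all_classical all_reals all_analysis.
From mathcomp Require Import ring lra.
Import Order.TTheory GRing.Theory Num.Theory.
Import numFieldNormedType.Exports.
Local Open Scope classical_set_scope.
Local Open Scope ring_scope.
Set Implicit Arguments.
Unset Strict Implicit.
Unset Printing Implicit Defensive.

(** * Calculus in finite-dimensional spaces *)

Section VectorCalculus.
Variable R : realType.
Implicit Types U V W : vectType R.

Definition vb V (i : 'I_(\dim {:V})) : V := (vbasis {:V})`_i.

Definition vcoord V (i : 'I_(\dim {:V})) : 'Hom(V, R^o) :=
  linfun (coord (vbasis {:V}) i).

Lemma vcoordE V i (v : V) : vcoord i v = coord (vbasis {:V}) i v.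
Proof. by rewrite /vcoord lfunE. Qed.

Lemma vcoord_sum V (v : V) : v = \sum_i vcoord i v *: vb i.
Proof.
rewrite {1}(coord_vbasis (memvf v)); apply: eq_bigr => i _.
by rewrite vcoordE.
Qed.

Lemma vcoord_vb V (i j : 'I_(\dim {:V})) : vcoord i (vb j) = (j == i)%:R.
Proof.
by rewrite vcoordE /vb coord_free ?(basis_free (vbasisP _)).
Qed.

Lemma vcoord_eq V (u v : V) : (forall i, vcoord i u = vcoord i v) -> u = v.
Proof.
move=> uv; rewrite (vcoord_sum u) (vcoord_sum v).
by apply: eq_bigr => i _; rewrite uv.
Qed.

Lemma dualZ V (f : 'Hom(V, R^o)) (a : R) v : f (a *: v) = a * f v :> R.
Proof. by rewrite linearZ. Qed.

Lemma vcoord_vecof V (a : 'I_(\dim {:V}) -> R) i :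
  vcoord i (\sum_j a j *: vb j) = a i.
Proof.
rewrite linear_sum (bigD1 i)//= dualZ vcoord_vb eqxx /= big1 ?addr0 ?mulr1//.
by move=> j ji; rewrite dualZ vcoord_vb (negPf ji) mulr0.
Qed.

Definition evalv V W (x : V) : 'Hom('Hom(V, W), W) := linfun (fun A : 'Hom(V, W) => A x).

Lemma evalv_linear V W (x : V) : linear (fun A : 'Hom(V, W) => A x).
Proof. by move=> a A B; rewrite add_lfunE scale_lfunE. Qed.

Lemma linfunE V W (f : V -> W) : linear f -> forall x, linfun f x = f x.
Proof.
move=> lf x; pose H := GRing.isLinear.Build R _ _ _ f lf.
by pose F : {linear V -> W} := HB.pack f H; exact: (lfunE F).
Qed.

Lemma evalvE V W (x : V) (A : 'Hom(V, W)) : evalv W x A = A x.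
Proof. exact: (linfunE (@evalv_linear V W x)). Qed.

(** An operator depends linearly on its values at the basis vectors; the pointwise criteria below
    for limits, derivatives and Lipschitz bounds of operator-valued maps all rest on this. *)
Lemma hom_rank1 V W :
  exists rk : 'I_(\dim {:V}) -> 'Hom(W, 'Hom(V, W)),
    forall A : 'Hom(V, W), A = \sum_i rk i (A (vb i)).
Proof.
pose rk (i : 'I_(\dim {:V})) (y : W) (x : V) := vcoord i x *: y.
have rkl i y : linear (rk i y).
  by move=> a u v; rewrite /rk linearP scalerDl scalerA.
have rkL i : linear (fun y => linfun (rk i y)).
  move=> a u v; apply/lfunP => x.
  rewrite add_lfunE scale_lfunE !(linfunE (rkl _ _)) /rk.
  by rewrite scalerDr !scalerA mulrC.
exists (fun i => linfun (fun y => linfun (rk i y))) => A.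
apply/lfunP => x; rewrite sum_lfunE {1}(vcoord_sum x) linear_sum.
by apply: eq_bigr => i _; rewrite (linfunE (rkL i)) (linfunE (rkl _ _)) linearZ.
Qed.

Lemma hom_dual V W (f : 'Hom('Hom(V, W), R^o)) :
  exists psi : 'I_(\dim {:V}) -> 'Hom(W, R^o),
    forall A, f A = \sum_i psi i (A (vb i)).
Proof.
have [rk rkE] := hom_rank1 V W; exists (fun i => (f \o rk i)%VF) => A.
by rewrite {1}(rkE A) linear_sum; apply: eq_bigr => i _; rewrite comp_lfunE.
Qed.

Lemma dual_eval V W (f : 'Hom(W, R^o)) (A : 'Hom(V, W)) x :
  f (A x) = \sum_i vcoord i x * f (A (vb i)) :> R.
Proof.
rewrite {1}(vcoord_sum x) !linear_sum; apply: eq_bigr => i _.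
by rewrite !linearZ.
Qed.

Lemma dual_coord V (f : 'Hom(V, R^o)) x :
  f x = \sum_i vcoord i x * f (vb i) :> R.
Proof.
rewrite {1}(vcoord_sum x) !linear_sum; apply: eq_bigr => i _.
by rewrite !linearZ.
Qed.

(** Testing on this functional turns [vlim] and [vder] of a scalar curve back into ordinary limits
    and derivatives. *)
Definition id_dual : 'Hom(R^o, R^o) := \1%VF.

(** The l1 norm in the fixed basis. It is unrelated to any inner product [g] and serves for
    estimates up to constants. *)
Definition vnorm V (v : V) : R := \sum_i `|vcoord i v : R|.

Lemma vnorm_ge0 V (v : V) : 0 <= vnorm v.
Proof. by apply: sumr_ge0. Qed.

Lemma vnorm_triangle V (u v : V) : vnorm (u + v) <= vnorm u + vnorm v.
Proof.
rewrite /vnorm -big_split/=; apply: ler_sum => i _.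
by rewrite linearD ler_normD.
Qed.

Lemma vnormZ V (a : R) (v : V) : vnorm (a *: v) = `|a| * vnorm v.
Proof.
rewrite /vnorm mulr_sumr; apply: eq_bigr => i _.
by rewrite dualZ normrM.
Qed.

Lemma vnormN V (v : V) : vnorm (- v) = vnorm v.
Proof. by rewrite -scaleN1r vnormZ normrN1 mul1r. Qed.

Lemma vnorm_sub V (u v : V) : vnorm (u - v) = vnorm (v - u).
Proof. by rewrite -vnormN opprB. Qed.

Lemma vnorm0 V : vnorm (0 : V) = 0.
Proof. by rewrite -(scale0r 0) vnormZ normr0 mul0r. Qed.

Lemma vcoord_le V (v : V) i : `|vcoord i v : R| <= vnorm v.
Proof. by rewrite /vnorm (bigD1 i)//= lerDl sumr_ge0. Qed.

Lemma vnorm_eq0 V (v : V) : vnorm v = 0 -> v = 0.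
Proof.
move=> v0; apply: vcoord_eq => i; apply/eqP; rewrite linear0 -normr_le0 -v0.
exact: vcoord_le.
Qed.

Lemma lin_bound V W (f : 'Hom(V, W)) :
  exists2 C : R, 0 <= C & forall v, vnorm (f v) <= C * vnorm v.
Proof.
exists (\sum_i vnorm (f (vb i))) => [|v]; first by apply: sumr_ge0 => i _; exact: vnorm_ge0.
have {1}-> : f v = \sum_i vcoord i v *: f (vb i).
  by rewrite {1}(vcoord_sum v) linear_sum; apply: eq_bigr => i _; rewrite linearZ.
have : forall (s : seq 'I_(\dim {:V})), vnorm (\sum_(i <- s) vcoord i v *: f (vb i)) <=
   \sum_(i <- s) vnorm (f (vb i)) * vnorm v.
  elim=> [|i s IH]; first by rewrite !big_nil vnorm0.
  rewrite !big_cons (le_trans (vnorm_triangle _ _))// lerD// vnormZ mulrC.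
  by rewrite ler_wpM2l ?vnorm_ge0 ?vcoord_le.
by rewrite mulr_suml; exact.
Qed.

Lemma dual_bound V (f : 'Hom(V, R^o)) :
  exists2 C : R, 0 <= C & forall v, `|f v : R| <= C * vnorm v.
Proof.
exists (\sum_i `|f (vb i) : R|) => [|v]; first exact: sumr_ge0.
rewrite (dual_coord f v) mulr_suml (le_trans (ler_norm_sum _ _ _))// ler_sum//.
by move=> i _; rewrite normrM mulrC ler_wpM2l ?vcoord_le.
Qed.

(* An abstract vectType carries no topology: convergence and differentiability
   are tested on linear functionals. *)
Definition vlim (T : Type) (F : set_system T) V (c : T -> V) (l : V) :=
  forall f : 'Hom(V, R^o), (fun s => f (c s) : R) @ F --> (f l : R).

Definition vder V (c : R -> V) (t : R) (d : V) :=
  forall f : 'Hom(V, R^o), is_derive t (1 : R) (fun s => f (c s) : R) (f d : R).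

Section Limits.
Variables (T : Type) (F : set_system T).
Context {FF : Filter F}.

Lemma vlim_lin V W (L : 'Hom(V, W)) c l : vlim F c l -> vlim F (L \o c) (L l).
Proof.
by move=> cl f; have := cl (f \o L)%VF; rewrite comp_lfunE; under eq_fun do rewrite comp_lfunE.
Qed.

Lemma vlim_cst V (l : V) : vlim F (fun=> l) l.
Proof. by move=> f; exact: cvg_cst. Qed.

Lemma vlimD V (c d : T -> V) l m :
  vlim F c l -> vlim F d m -> vlim F (fun s => c s + d s) (l + m).
Proof.
move=> cl dm f; rewrite linearD; under eq_fun do rewrite linearD.
by apply: cvgD; [exact: cl|exact: dm].
Qed.

Lemma vlimN V (c : T -> V) l : vlim F c l -> vlim F (fun s => - c s) (- l).
Proof.
move=> cl f; rewrite linearN; under eq_fun do rewrite linearN.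
by apply: cvgN; exact: cl.
Qed.

Lemma vlimB V (c d : T -> V) l m :
  vlim F c l -> vlim F d m -> vlim F (fun s => c s - d s) (l - m).
Proof. by move=> cl dm; apply: vlimD => //; exact: vlimN. Qed.

Lemma vlimZ V (a : R) (c : T -> V) l :
  vlim F c l -> vlim F (fun s => a *: c s) (a *: l).
Proof.
move=> cl f; rewrite dualZ; under eq_fun do rewrite dualZ.
by apply: cvgM; [exact: cvg_cst|exact: cl].
Qed.

Lemma cvg_sumR n (c : 'I_n -> T -> R) (l : 'I_n -> R) :
  (forall i, c i @ F --> l i) -> (fun s => \sum_i c i s) @ F --> \sum_i l i.
Proof.
move=> cl; apply: (cvg_big (op := +%R)) => [|i _]; [exact: add_continuous|exact: cl].
Qed.

Lemma vlim_hom V W (c : T -> 'Hom(V, W)) (l : 'Hom(V, W)) :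
  (forall x, vlim F (fun s => c s x) (l x)) -> vlim F c l.
Proof.
move=> cl f; have [psi fE] := hom_dual f.
rewrite fE; under eq_fun do rewrite fE.
by apply: cvg_sumR => i; exact: cl.
Qed.

Lemma vlim_coord V (c : T -> V) l :
  (forall i, (fun s => vcoord i (c s) : R) @ F --> (vcoord i l : R)) -> vlim F c l.
Proof.
move=> cl f; rewrite dual_coord; under eq_fun do rewrite dual_coord.
by apply: cvg_sumR => i; apply: cvgM => //; exact: cvg_cst.
Qed.

Lemma vlim_eval V W (c : T -> 'Hom(V, W)) (l : 'Hom(V, W)) v u :
  vlim F c l -> vlim F v u -> vlim F (fun s => c s (v s)) (l u).
Proof.
move=> cl vu f; rewrite dual_eval; under eq_fun do rewrite dual_eval.
apply: cvg_sumR => i; apply: cvgM; first exact: vu.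
by have /(_ f) := vlim_lin (L := evalv W (vb i)) cl; rewrite evalvE; under eq_fun do rewrite /= evalvE.
Qed.

Lemma vlim_app V W (c : T -> 'Hom(V, W)) (l : 'Hom(V, W)) x :
  vlim F c l -> vlim F (fun s => c s x) (l x).
Proof. by move=> cl; apply: vlim_eval => //; exact: vlim_cst. Qed.

Lemma vlim_comp U V W (c : T -> 'Hom(V, W)) (d : T -> 'Hom(U, V))
    (l : 'Hom(V, W)) (m : 'Hom(U, V)) :
  vlim F c l -> vlim F d m -> vlim F (fun s => c s \o d s)%VF (l \o m)%VF.
Proof.
move=> cl dm; apply: vlim_hom => x; rewrite comp_lfunE.
under eq_fun do rewrite comp_lfunE.
by apply: vlim_eval => //; exact: vlim_app.
Qed.

Lemma vlim_scalar (c : T -> R^o) (l : R^o) : vlim F c l <-> (c : T -> R) @ F --> (l : R).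
Proof.
split=> [/(_ id_dual)|cl f].
  by rewrite id_lfunE; under eq_fun do rewrite id_lfunE.
have fE x : f x = (f 1 : R) * x :> R.
  by rewrite -[x in LHS]mulr1 -[x * 1]/(x *: (1 : R^o)) linearZ mulrC.
rewrite fE; under eq_fun do rewrite fE.
by apply: cvgM => //; exact: cvg_cst.
Qed.

Lemma vlim_normP V (c : T -> V) l :
  vlim F c l <-> (fun s => vnorm (c s - l)) @ F --> (0 : R).
Proof.
split=> cl.
  have -> : 0 = vnorm (l - l) by rewrite subrr vnorm0.
  have cll : vlim F (fun s => c s - l) (l - l) by apply: vlimB => //; exact: vlim_cst.
  by apply: cvg_sumR => i; apply: cvg_norm; exact: cll.
move=> f; have [C C0 fC] := dual_bound f.
apply/cvgrPdistC_le => e e0.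
have Ce : 0 < e / (C + 1) by rewrite divr_gt0 // ltr_wpDl.
move/cvgr_distC_lt : cl => /(_ _ Ce); apply: filterS => s.
rewrite subr0 ger0_norm ?vnorm_ge0// => se.
rewrite -linearB (le_trans (fC _))// (@le_trans _ _ (C * (e / (C + 1))))//.
  by rewrite ler_wpM2l// ltW.
rewrite mulrCA ger_pMr// ler_pdivrMr ?mul1r ?lerDl//.
by rewrite ltr_wpDl.
Qed.

Lemma vlim_norm V (c : T -> V) l e : vlim F c l -> 0 < e ->
  \forall s \near F, vnorm (c s - l) < e.
Proof.
move=> /vlim_normP/cvgr_distC_lt /[apply]; apply: filterS => s.
by rewrite subr0 ger0_norm ?vnorm_ge0.
Qed.

Lemma norm_vlim V (c : T -> V) l :
  (forall e, 0 < e -> \forall s \near F, vnorm (c s - l) <= e) -> vlim F c l.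
Proof.
move=> H; apply/vlim_normP/cvgrPdistC_le => e /H; apply: filterS => s.
by rewrite subr0 ger0_norm ?vnorm_ge0.
Qed.

Lemma vlim_near V (c d : T -> V) l :
  (\forall s \near F, c s = d s) -> vlim F c l -> vlim F d l.
Proof.
move=> cd cl; apply: norm_vlim => e e0; near=> s.
have <- : c s = d s by near: s.
by apply: ltW; near: s; exact: vlim_norm.
Unshelve. all: by end_near. Qed.

Lemma vlim_squeeze V (c : T -> V) l (b : T -> R) : b @ F --> (0 : R) ->
  (\forall s \near F, vnorm (c s - l) <= b s) -> vlim F c l.
Proof.
move=> /cvgr_distC_lt b0 cb; apply: norm_vlim => e /b0 be.
near=> s; rewrite (@le_trans _ _ (b s))//; first by near: s.
have : `|b s - 0| < e by near: s.
by rewrite subr0 => /ltW; apply: le_trans; exact: ler_norm.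
Unshelve. all: by end_near. Qed.

End Limits.

Lemma vlim_uniq (T : Type) (F : set_system T) {FF : ProperFilter F} V
  (c : T -> V) l m : vlim F c l -> vlim F c m -> l = m.
Proof.
move=> cl cm; apply: vcoord_eq => i.
exact: (cvg_unique (@Rhausdorff R) (cl (vcoord i)) (cm (vcoord i))).
Qed.

End VectorCalculus.

(** * Derivatives of curves and locally Lipschitz maps *)

Section Derivatives.
Variable R : realType.
Implicit Types U V W : vectType R.

Lemma is_derive_sumR n (c : 'I_n -> R -> R) (d : 'I_n -> R) (t : R) :
  (forall i, is_derive t (1 : R) (c i) (d i)) ->
  is_derive t (1 : R) (fun s => \sum_i c i s) (\sum_i d i).
Proof. by move=> cd; have := is_derive_sum cd; rewrite fct_sumE. Qed.

Lemma vder_lin V W (L : 'Hom(V, W)) (c : R -> V) t d :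
  vder c t d -> vder (L \o c) t (L d).
Proof.
by move=> cd f; have := cd (f \o L)%VF; rewrite comp_lfunE; under eq_fun do rewrite comp_lfunE.
Qed.

Lemma vder_cst V (v : V) t : vder (fun=> v) t 0.
Proof. by move=> f; rewrite linear0; exact: is_derive_cst. Qed.

Lemma vderD V (c e : R -> V) t d d' : vder c t d -> vder e t d' ->
  vder (fun s => c s + e s) t (d + d').
Proof.
move=> cd ed f; rewrite linearD; under eq_fun do rewrite linearD.
by apply: is_deriveD; [exact: cd|exact: ed].
Qed.

Lemma vderN V (c : R -> V) t d : vder c t d -> vder (fun s => - c s) t (- d).
Proof.
move=> cd f; rewrite linearN; under eq_fun do rewrite linearN.
by apply: is_deriveN; exact: cd.
Qed.

Lemma vder_hom V W (c : R -> 'Hom(V, W)) t (d : 'Hom(V, W)) :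
  (forall x, vder (fun s => c s x) t (d x)) -> vder c t d.
Proof.
move=> cd f; have [psi fE] := hom_dual f.
rewrite fE; under eq_fun do rewrite fE.
by apply: is_derive_sumR => i; exact: cd.
Qed.

Lemma vder_coord V (c : R -> V) t d :
  (forall i, is_derive t (1 : R) (fun s => vcoord i (c s) : R) (vcoord i d : R)) ->
  vder c t d.
Proof.
move=> cd f; rewrite dual_coord; under eq_fun do rewrite dual_coord.
apply: is_derive_sumR => i.
apply: (is_derive_eq (is_deriveM (cd i) (is_derive_cst (f (vb i) : R) t (1 : R)))).
by rewrite scaler0 add0r; exact: mulrC.
Qed.

Lemma vder_eval V W (c : R -> 'Hom(V, W)) (d : 'Hom(V, W)) (v : R -> V) u t :
  vder c t d -> vder v t u ->
  vder (fun s => c s (v s)) t (c t u + d (v t)).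
Proof.
move=> cd vu f; rewrite linearD /= (dual_eval f (c t)) (dual_eval f d) -big_split/=.
under eq_fun do rewrite dual_eval.
apply: is_derive_sumR => i.
have cdi : is_derive t (1 : R) (fun s => f (c s (vb i)) : R) (f (d (vb i)) : R).
  have /(_ f) := vder_lin (evalv W (vb i)) cd.
  by rewrite evalvE; under eq_fun do rewrite /= evalvE.
apply: (is_derive_eq (is_deriveM (vu (vcoord i)) cdi)).
by rewrite addrC; congr (_ + _); exact: mulrC.
Qed.

Lemma vder_app V W (c : R -> 'Hom(V, W)) (d : 'Hom(V, W)) t x :
  vder c t d -> vder (fun s => c s x) t (d x).
Proof.
by move=> /vder_eval/(_ (vder_cst x t)); rewrite linear0 add0r.
Qed.

Lemma vder_comp U V W (c : R -> 'Hom(V, W)) (d : R -> 'Hom(U, V))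
    (c' : 'Hom(V, W)) (d' : 'Hom(U, V)) t :
  vder c t c' -> vder d t d' ->
  vder (fun s => c s \o d s)%VF t ((c t \o d') + (c' \o d t))%VF.
Proof.
move=> cc' dd'; apply: vder_hom => x.
rewrite add_lfunE !comp_lfunE; under eq_fun do rewrite comp_lfunE.
by apply: vder_eval => //; exact: vder_app.
Qed.

Lemma is_derive_cvg (f : R -> R) t d : is_derive t (1 : R) f d -> f @ t --> f t.
Proof.
by case=> fd _; apply: differentiable_continuous; apply/derivable1_diffP.
Qed.

Lemma vder_vlim V (c : R -> V) t d : vder c t d -> vlim (nbhs t) c (c t).
Proof. by move=> cd f; have := is_derive_cvg (cd f). Qed.

Lemma vder_scalar (c : R -> R^o) t (d : R^o) :
  vder c t d <-> is_derive t (1 : R) (c : R -> R) (d : R).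
Proof.
split=> [/(_ (id_dual R))|cd f].
  by rewrite id_lfunE; under eq_fun do rewrite id_lfunE.
have fE x : f x = (f 1 : R) * x :> R.
  by rewrite -[x in LHS]mulr1 -[x * 1]/(x *: (1 : R^o)) linearZ mulrC.
rewrite fE; under eq_fun do rewrite fE.
apply: (is_derive_eq (is_deriveM (is_derive_cst (f 1 : R) t (1 : R)) cd)).
by rewrite scaler0 addr0.
Qed.

Lemma MVT_open (f df : R -> R) (a b : R) : a < b ->
  (forall x, a <= x <= b -> is_derive x (1 : R) f (df x)) ->
  exists2 c, a < c < b & f b - f a = df c * (b - a).
Proof.
move=> ab fd.
have [x||c] := @MVT R f df a b ab.
- by rewrite in_itv/= => /andP[ax xb]; apply: fd; rewrite !ltW.
- apply: derivable_within_continuous => x; rewrite in_itv/= => axb.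
  by have [] := fd _ axb.
- by rewrite in_itv/=; exists c.
Qed.

(** The mean value theorem is applied to each coordinate, at its own intermediate point; summing
    over the coordinates costs the dimension factor. *)
Lemma vder_mean V (c d : R -> V) (a b K : R) : a <= b ->
  (forall x, a <= x <= b -> vder c x (d x) /\ vnorm (d x) <= K) ->
  vnorm (c b - c a) <= (\dim {:V})%:R * K * (b - a).
Proof.
rewrite le_eqVlt => /predU1P[->|ab] cd.
  by rewrite !subrr vnorm0 mulr0.
rewrite -mulrA mulr_natl -[X in _ *+ X]card_ord -sumr_const; apply: ler_sum => i _.
rewrite linearB /=; have [x axb ->] := MVT_open ab (fun x xab => (cd x xab).1 (vcoord i)) :
  exists2 x, a < x < b & (vcoord i (c b) - vcoord i (c a) : R) = (vcoord i (d x) : R) * (b - a).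
rewrite normrM (gtr0_norm (_ : 0 < b - a)) ?subr_gt0// ler_wpM2r ?subr_ge0 ?(ltW ab)//.
have [|_ dK] := cd x; first by case/andP: axb => /ltW-> /ltW->.
exact: le_trans (vcoord_le _ _) dK.
Qed.

Lemma vder0_cst V (c : R -> V) (a b : R) :
  (forall x, a < x < b -> vder c x 0) ->
  forall s t, a < s < b -> a < t < b -> c s = c t.
Proof.
move=> c0; suff H s t : s <= t -> a < s < b -> a < t < b -> c s = c t.
  move=> s t sab tab; have [st|/ltW ts] := leP s t; first exact: H.
  by apply/esym; exact: H.
move=> st /andP[as_ sb] /andP[at_ tb].
apply/esym/eqP; rewrite -subr_eq0; apply/eqP/vnorm_eq0/eqP.
rewrite eq_le vnorm_ge0 andbT.
have := @vder_mean _ c (fun=> 0) s t 0 st; rewrite mulr0 mul0r; apply.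
move=> x /andP[sx xt]; split; last by rewrite vnorm0.
by apply: c0; rewrite (lt_le_trans as_ sx) (le_lt_trans xt tb).
Qed.

(** Both points range over a ball around [x0], rather than one being [x0] itself, because Picard
    iteration compares two nearby states. *)
Definition vlip V W (f : V -> W) (x0 : V) := exists r L : R,
  [/\ 0 < r, 0 <= L & forall x y, vnorm (x - x0) <= r -> vnorm (y - x0) <= r ->
      vnorm (f x - f y) <= L * vnorm (x - y)].

Lemma vlip_cst V W (w : W) (x0 : V) : vlip (fun=> w) x0.
Proof. by exists 1, 0; split=> // x y _ _; rewrite subrr vnorm0 mul0r. Qed.

Lemma vlip_lin V W (f : 'Hom(V, W)) (x0 : V) : vlip f x0.
Proof.
have [C C0 fC] := lin_bound f; exists 1, C; split=> // x y _ _.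
by rewrite -linearB; exact: fC.
Qed.

Lemma vlip_bound V W (f : V -> W) x0 : vlip f x0 ->
  exists r L M : R, [/\ 0 < r, 0 <= L, 0 <= M,
    (forall x, vnorm (x - x0) <= r -> vnorm (f x) <= M) &
    forall x y, vnorm (x - x0) <= r -> vnorm (y - x0) <= r ->
      vnorm (f x - f y) <= L * vnorm (x - y)].
Proof.
move=> [r [L [r0 L0 fL]]]; exists r, L, (vnorm (f x0) + L * r); split=> //.
  by rewrite addr_ge0 ?vnorm_ge0 ?mulr_ge0 ?(ltW r0).
move=> x xr; rewrite -(subrK (f x0) (f x)) addrC.
rewrite (le_trans (vnorm_triangle _ _))// lerD// (le_trans (fL _ _ _ _))//.
  by rewrite subrr vnorm0 (ltW r0).
by rewrite ler_wpM2l.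
Qed.

Lemma vlip_comp U V W (g : V -> W) (f : U -> V) x0 :
  vlip f x0 -> vlip g (f x0) -> vlip (g \o f) x0.
Proof.
move=> [r [L [r0 L0 fL]]] [r' [L' [r'0 L'0 gL]]].
exists (Num.min r (r' / (L + 1))), (L' * L).
have L10 : 0 < L + 1 by rewrite ltr_wpDl.
split; [by rewrite lt_min r0 divr_gt0|by rewrite mulr_ge0|].
have aux x : vnorm (x - x0) <= Num.min r (r' / (L + 1)) ->
    vnorm (x - x0) <= r /\ vnorm (f x - f x0) <= r'.
  rewrite le_min => /andP[xr]; rewrite ler_pdivlMr// => xr'; split=> //.
  rewrite (le_trans (fL _ _ xr _)) ?subrr ?vnorm0 ?(ltW r0)//.
  rewrite (le_trans _ xr')// mulrC ler_wpM2l ?vnorm_ge0// lerDl//.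
move=> x y /aux[xr xr'] /aux[yr yr'] /=.
by rewrite (le_trans (gL _ _ xr' yr'))// -mulrA ler_wpM2l// fL.
Qed.

Lemma vlipD V W (f g : V -> W) x0 :
  vlip f x0 -> vlip g x0 -> vlip (fun x => f x + g x) x0.
Proof.
move=> [r [L [r0 L0 fL]]] [r' [L' [r'0 L'0 gL]]].
exists (Num.min r r'), (L + L'); split; [by rewrite lt_min r0|by rewrite addr_ge0|].
move=> x y; rewrite !le_min => /andP[xr xr'] /andP[yr yr'].
rewrite opprD addrACA (le_trans (vnorm_triangle _ _))// mulrDl lerD//.
  exact: fL.
exact: gL.
Qed.

Lemma vlip_sum V W n (f : 'I_n -> V -> W) x0 :
  (forall i, vlip (f i) x0) -> vlip (fun x => \sum_i f i x) x0.
Proof.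
move=> fL; elim: (index_enum _) => [|i s IH].
  by under eq_fun do rewrite big_nil; exact: vlip_cst.
by under eq_fun do rewrite big_cons; exact: vlipD.
Qed.

Lemma vlip_linl U V W (L : 'Hom(V, W)) (f : U -> V) x0 :
  vlip f x0 -> vlip (fun x => L (f x)) x0.
Proof. by move=> fL; apply: (vlip_comp (g := L)) => //; exact: vlip_lin. Qed.

Lemma vlip_hom U V W (f : U -> 'Hom(V, W)) x0 :
  (forall v, vlip (fun x => f x v) x0) -> vlip f x0.
Proof.
move=> fL; have [rk rkE] := hom_rank1 V W.
have -> : f = fun x => \sum_i rk i (f x (vb i)) by apply/funext => x; exact: rkE.
by apply: vlip_sum => i; exact: vlip_linl.
Qed.

Lemma vlip_app U V W (f : U -> 'Hom(V, W)) v x0 :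
  vlip f x0 -> vlip (fun x => f x v) x0.
Proof.
by move=> /(vlip_linl (evalv W v)); under eq_fun do rewrite evalvE.
Qed.

(** [vnorm] on a space of operators is read in a basis of that space, so it controls evaluation only
    up to a constant. *)
Lemma eval_bound V W : exists2 C : R, 0 <= C &
  forall (A : 'Hom(V, W)) v, vnorm (A v) <= C * vnorm A * vnorm v.
Proof.
have H (i : 'I_(\dim {:V})) : exists C : R, 0 <= C /\
    forall A : 'Hom(V, W), vnorm (A (vb i)) <= C * vnorm A.
  have [C C0 CE] := lin_bound (evalv W (vb i)).
  by exists C; split=> // A; rewrite -evalvE.
have [C CP] := choice H.
have C0 i : 0 <= C i by case: (CP i).
have CE i (A : 'Hom(V, W)) : vnorm (A (vb i)) <= C i * vnorm A by case: (CP i).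
exists (\sum_i C i); first by apply: sumr_ge0.
move=> A v; have {1}-> : A v = \sum_i vcoord i v *: A (vb i).
  by rewrite {1}(vcoord_sum v) linear_sum; apply: eq_bigr => i _; rewrite linearZ.
rewrite !mulr_suml; elim/big_ind2: _ => [|x a y b xa yb|i _].
- by rewrite vnorm0.
- by rewrite (le_trans (vnorm_triangle _ _))// lerD.
by rewrite vnormZ mulrC ler_pM ?vnorm_ge0 ?vcoord_le.
Qed.

Lemma vlip_eval U V W (f : U -> 'Hom(V, W)) (v : U -> V) x0 :
  vlip f x0 -> vlip v x0 -> vlip (fun x => f x (v x)) x0.
Proof.
move=> /vlip_bound[r [L [M [r0 L0 M0 fM fL]]]].
move=> /vlip_bound[r' [L' [M' [r'0 L'0 M'0 gM gL]]]].
have [C C0 CE] := eval_bound V W.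
exists (Num.min r r'), (C * (L * M' + M * L')); split.
- by rewrite lt_min r0.
- by rewrite mulr_ge0// addr_ge0// mulr_ge0.
move=> x y; rewrite !le_min => /andP[xr xr'] /andP[yr yr'].
have -> : f x (v x) - f y (v y) = (f x - f y) (v x) + f y (v x - v y).
  by rewrite add_lfunE opp_lfunE linearB addrA subrK.
rewrite (le_trans (vnorm_triangle _ _))// mulrDr mulrDl lerD//.
  rewrite (le_trans (CE _ _))// -!mulrA ler_wpM2l// mulrC [M' * _]mulrC mulrA.
  by rewrite mulrC ler_pM ?vnorm_ge0 ?gM// fL.
rewrite (le_trans (CE _ _))// -!mulrA ler_wpM2l//.
by rewrite ler_pM ?vnorm_ge0 ?fM// gL.
Qed.

Lemma vlip_lfcomp U1 U V W (f : U1 -> 'Hom(V, W)) (g : U1 -> 'Hom(U, V)) x0 :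
  vlip f x0 -> vlip g x0 -> vlip (fun x => f x \o g x)%VF x0.
Proof.
move=> fL gL; apply: vlip_hom => v; under eq_fun do rewrite comp_lfunE.
by apply: vlip_eval => //; exact: vlip_app.
Qed.

Lemma vlip_vlim T (F : set_system T) {FF : Filter F} V W (f : V -> W) (c : T -> V) x0 :
  vlip f x0 -> vlim F c x0 -> vlim F (f \o c) (f x0).
Proof.
move=> [r [L [r0 L0 fL]]] cx; apply: (@vlim_squeeze _ _ F FF _ _ _ (fun s => L * vnorm (c s - x0))).
  rewrite -[X in _ --> X](mulr0 L); apply: cvgM; first exact: cvg_cst.
  exact/vlim_normP.
apply: (@filterS _ F FF _ _ _ (vlim_norm cx r0)) => s sr.
by rewrite fL ?subrr ?vnorm0 ?(ltW r0) ?(ltW sr).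
Qed.

End Derivatives.

(** * Perturbation of the identity *)

Section Perturbation.
Variable R : realType.
Implicit Types U V W : vectType R.

Lemma bil_linl V (B : bilform R V) (a : R) u v y :
  B (a *: u + v) y = a * B u y + B v y :> R.
Proof. by rewrite linearP add_lfunE scale_lfunE. Qed.

Lemma bil_linr V (B : bilform R V) (a : R) x u v :
  B x (a *: u + v) = a * B x u + B x v :> R.
Proof. by rewrite linearP. Qed.

Lemma vlim_le (T : Type) (F : set_system T) {FF : ProperFilter F} V
    (c : T -> V) (l a : V) (K : R) :
  vlim F c l -> (\forall s \near F, vnorm (c s - a) <= K) -> vnorm (l - a) <= K.
Proof.
move=> cl cK; apply/ler_addgt0Pr => e e0.
have : \forall s \near F, vnorm (l - a) <= K + e.
  near=> s; rewrite -(subrK (c s) l) -addrA (le_trans (vnorm_triangle _ _))//.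
  rewrite [K + e]addrC lerD//; last by near: s.
  by rewrite vnorm_sub ltW//; near: s; exact: vlim_norm.
by move=> /filter_ex[].
Unshelve. all: by end_near. Qed.

(** In each coordinate, x_k - 2C/2^k increases, x_k + 2C/2^k decreases, and the first stays below
    the second. Monotone convergence gives the limit, which lies between them; 2C/2^k is the sum of
    the remaining increments. *)
Lemma geometric_vlim V (u : nat -> V) (C : R) :
  (forall k, vnorm (u k.+1 - u k) <= C / 2 ^+ k) ->
  exists2 l, vlim \oo u l &
    forall k, vnorm (l - u k) <= (\dim {:V})%:R * (2 * C / 2 ^+ k).
Proof.
move=> uC.
pose x i k : R := vcoord i (u k).
have xC i k : `|x i k.+1 - x i k| <= C / 2 ^+ k.
  by apply: le_trans (uC k); rewrite /x -linearB; exact: vcoord_le.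
have p2 k : (2 ^+ k.+1 : R)^-1 = (2 ^+ k)^-1 / 2 by rewrite exprS invfM mulrC.
pose y i k := x i k - 2 * C / 2 ^+ k; pose z i k := x i k + 2 * C / 2 ^+ k.
have yS i : nondecreasing_seq (y i).
  apply/nondecreasing_seqP => k; rewrite /y p2.
  by have := xC i k; rewrite ler_norml => /andP[]; set c := (2 ^+ k)^-1; lra.
have zS i : nonincreasing_seq (z i).
  apply/nonincreasing_seqP => k; rewrite /z p2.
  by have := xC i k; rewrite ler_norml => /andP[]; set c := (2 ^+ k)^-1; lra.
have C0 : 0 <= C by have := le_trans (vnorm_ge0 _) (uC 0%N); rewrite expr0 divr1.
have yz i k : y i k <= z i k.
  by rewrite /y /z lerD2l ge0_cp// !mulr_ge0// invr_ge0 exprn_ge0.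
have yzmn i m n : y i m <= z i n.
  rewrite (le_trans (yS i _ _ (leq_maxl m n)))// (le_trans (yz _ _))//.
  exact: zS (leq_maxr m n).
have ycvg i : cvgn (y i).
  apply: nondecreasing_is_cvgn (yS i) _.
  by exists (z i 0%N) => _ [k _ <-].
pose l i := limn (y i).
have yl i k : y i k <= l i by apply: nondecreasing_cvgn_le (yS i) (ycvg i) k.
have lz i k : l i <= z i k by apply: limr_le (ycvg i) _; apply: nearW => m.
have lx i k : `|l i - x i k| <= 2 * C / 2 ^+ k.
  by have := yl i k; have := lz i k; rewrite ler_norml /y /z => ? ?; apply/andP; split; lra.
exists (\sum_i l i *: vb i); last first.
  move=> k; rewrite mulr_natl -[X in _ *+ X]card_ord -sumr_const.
  by apply: ler_sum => i _; rewrite linearB /= vcoord_vecof lx.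
apply: vlim_coord => i; rewrite vcoord_vecof.
have -> : (fun s => vcoord i (u s) : R) = (fun k => y i k + 2 * C / 2 ^+ k).
  by apply/funext => k; rewrite /y subrK.
rewrite -[l i]addr0; apply: cvgD; first exact: ycvg.
have -> : (fun k => 2 * C / 2 ^+ k) = geometric (2 * C) (2^-1 : R).
  by apply/funext => k; rewrite /geometric /= exprVn.
by apply: cvg_geometric; rewrite ger0_norm ?invr_ge0// invf_lt1 ?ltr1n.
Qed.

Lemma hom_bound V W : exists2 C : R, 0 <= C &
  forall A : 'Hom(V, W), vnorm A <= C * \sum_i vnorm (A (vb i)).
Proof.
have [rk rkE] := hom_rank1 V W.
have [C CP] := choice (fun i => let: ex_intro2 C C0 CE := lin_bound (rk i) in
  ex_intro (fun C => 0 <= C /\ forall y, vnorm (rk i y) <= C * vnorm y) C (conj C0 CE)).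
exists (\sum_i C i) => [|A]; first by apply: sumr_ge0 => i _; case: (CP i).
rewrite {1}(rkE A) mulr_suml; elim/big_ind2: _ => [|x a y b xa yb|i _].
- by rewrite vnorm0.
- by rewrite (le_trans (vnorm_triangle _ _))// lerD.
rewrite (le_trans ((CP i).2 _))// ler_wpM2l ?(CP i).1//.
by rewrite (bigD1 i)//= lerDl sumr_ge0// => j _; exact: vnorm_ge0.
Qed.

Lemma comp_bound U V W : exists2 C : R, 0 <= C &
  forall (A : 'Hom(V, W)) (B : 'Hom(U, V)), vnorm (A \o B)%VF <= C * vnorm A * vnorm B.
Proof.
have [C C0 CE] := hom_bound U W.
have [D D0 DE] := eval_bound V W; have [E E0 EE] := eval_bound U V.
pose S : R := \sum_i vnorm (vb i : U).
have S0 : 0 <= S by apply: sumr_ge0 => i _; exact: vnorm_ge0.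
exists (C * (D * (E * S))) => [|A B]; first by rewrite !mulr_ge0.
apply: le_trans (CE _) _; rewrite -!mulrA ler_wpM2l//.
have -> : D * (E * (S * (vnorm A * vnorm B))) = D * vnorm A * (E * vnorm B) * S by ring.
rewrite mulr_sumr; apply: ler_sum => i _; rewrite comp_lfunE.
by apply: le_trans (DE _ _) _; rewrite -[X in _ <= X]mulrA ler_wpM2l ?mulr_ge0 ?vnorm_ge0.
Qed.

Section NearOne.
Variables (T : Type) (F : set_system T).
Context {FF : Filter F}.

Lemma near_one_half V (M : T -> 'End(V)) : vlim F M \1%VF ->
  \forall s \near F, forall x, vnorm ((M s - \1%VF) x) <= 2^-1 * vnorm x.
Proof.
move=> M1; have [C C0 CE] := eval_bound V V.
have e0 : 0 < 2^-1 / (C + 1) by rewrite divr_gt0 ?invr_gt0// ltr_wpDl.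
apply: filterS (vlim_norm M1 e0) => s.
rewrite ltr_pdivlMr ?ltr_wpDl// => Ms x; rewrite (le_trans (CE _ _))//.
rewrite ler_wpM2r ?vnorm_ge0// (le_trans _ (ltW Ms))// mulrC.
by rewrite ler_wpM2l ?vnorm_ge0 ?lerDl.
Qed.

Lemma near_one_bound V (M : T -> 'End(V)) : vlim F M \1%VF ->
  \forall s \near F, forall x, vnorm x <= 2 * vnorm (M s x).
Proof.
move=> /near_one_half; apply: filterS => s Ms x.
have := Ms x; rewrite add_lfunE opp_lfunE id_lfunE.
have := vnorm_triangle (M s x) (x - M s x).
by rewrite addrC subrK (vnorm_sub x); lra.
Qed.

Lemma near_one_lker0 V (M : T -> 'End(V)) : vlim F M \1%VF ->
  \forall s \near F, lker (M s) == 0%VS.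
Proof.
move=> /near_one_bound; apply: filterS => s Ms.
rewrite -subv0; apply/subvP => x; rewrite memv_ker memv0 => /eqP Mx.
apply/eqP/vnorm_eq0/eqP; rewrite eq_le vnorm_ge0 andbT.
by rewrite (le_trans (Ms x))// Mx vnorm0 mulr0.
Qed.

(** From M X = Y one has X - y = (Y - y) - (M - 1) X, and |X| <= 2 |Y| once M is close to 1. Limits
    of solutions are thus reached without continuity of operator inversion. *)
Lemma near_one_solve V (M : T -> 'End(V)) (X Y : T -> V) y : vlim F M \1%VF ->
  (\forall s \near F, M s (X s) = Y s) -> vlim F Y y -> vlim F X y.
Proof.
move=> M1 MX Yy; have [C C0 CE] := eval_bound V V.
pose b s := vnorm (Y s - y) + C * vnorm (M s - \1%VF) * (2 * (vnorm y + 1)).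
apply: (@vlim_squeeze _ _ F FF _ _ _ b).
  rewrite -[X in _ --> X](addr0 0); apply: cvgD; first exact/vlim_normP.
  rewrite -[X in _ --> X](mul0r (2 * (vnorm y + 1))); apply: cvgM; last exact: cvg_cst.
  rewrite -[X in _ --> X](mulr0 C); apply: cvgM; first exact: cvg_cst.
  exact/vlim_normP.
near=> s.
have Xs : vnorm (X s) <= 2 * vnorm (Y s).
  have <- : M s (X s) = Y s by near: s.
  by move: (X s); near: s; exact: near_one_bound.
have Ys : vnorm (Y s) <= vnorm y + 1.
  rewrite -[Y s](subrK y) (le_trans (vnorm_triangle _ _))// addrC lerD2l.
  by apply: ltW; near: s; exact: vlim_norm.
have -> : X s - y = (Y s - y) - (M s - \1%VF) (X s).
  have -> : Y s = M s (X s) by apply/esym; near: s.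
  by rewrite add_lfunE opp_lfunE id_lfunE opprB [RHS]addrC addrA subrK.
rewrite (le_trans (vnorm_triangle _ _))// /b lerD2l vnormN (le_trans (CE _ _))//.
rewrite ler_wpM2l ?mulr_ge0 ?vnorm_ge0//; lra.
Unshelve. all: by end_near. Qed.

Lemma nondeg_eq V (B : bilform R V) u v : Defs.nondegenerate B ->
  (forall y, B u y = B v y) -> u = v.
Proof.
move=> Bnd uv; apply/eqP; rewrite -subr_eq0; apply/eqP/Bnd => y.
by rewrite linearB add_lfunE opp_lfunE uv subrr.
Qed.

(** Applying [form_op B0] to the equation B X = b turns it into M X = Y with M tending to the
    identity, the case of [near_one_solve]. *)
Lemma form_op_vlim V (B b : T -> bilform R V) (B0 b0 : bilform R V) :
  Defs.nondegenerate B0 -> (\forall s \near F, Defs.nondegenerate (B s)) ->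
  vlim F B B0 -> vlim F b b0 ->
  vlim F (fun s => form_op (B s) (b s)) (form_op B0 b0).
Proof.
move=> B0nd Bnd BB0 bb0; apply: vlim_hom => x.
have lim c c0 : vlim F c c0 -> vlim F (fun s => form_op B0 (c s)) (form_op B0 c0).
  by move=> cc0; apply: vlim_comp => //; exact: vlim_cst.
have B01 : form_op B0 B0 = \1%VF.
  apply/lfunP => u; rewrite id_lfunE; apply: (nondeg_eq B0nd) => y.
  by rewrite form_opE.
apply: (near_one_solve (M := fun s => form_op B0 (B s))
  (Y := fun s => form_op B0 (b s) x)).
- by rewrite -B01; exact: lim.
- apply: filterS Bnd => s Bs; apply: (nondeg_eq B0nd) => y.
  by rewrite !form_opE.
- by apply: vlim_app; exact: lim.
Qed.

End NearOne.

(* The square root 1 - Y of S near the identity is found by iterating the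
   contraction Y |-> (1 - S + Y^2) / 2, which preserves every linear condition
   that S satisfies together with its powers. *)
Lemma lfun_sqrt V : exists2 c : R, 0 < c & forall S : 'End(V), vnorm (S - \1%VF) <= c ->
  exists X : 'End(V), [/\ (X \o X)%VF = S, vnorm (X - \1%VF) <= vnorm (S - \1%VF),
    forall J, (S \o J)%VF = (J \o S)%VF -> (X \o J)%VF = (J \o X)%VF &
    forall B : bilform R V, (forall x y, B (S x) y = B x (S y)) ->
      forall x y, B (X x) y = B x (X y)].
Proof.
have [K K0 KE] := comp_bound V V V.
(* This radius forces K |Z| <= 1/2, which keeps the iterates in the ball of radius |Z| and gives the
   contraction factor 1/2. *)
exists (2^-1 / (K + 1)) => [|S]; first by rewrite divr_gt0 ?invr_gt0// ltr_wpDl.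
set Z := \1%VF - S; rewrite vnorm_sub -/Z ler_pdivlMr ?ltr_wpDl// => ZK.
have {}ZK : K * vnorm Z <= 2^-1.
  by rewrite (le_trans _ ZK)// mulrC ler_wpM2l ?vnorm_ge0 ?lerDl.
pose step (Y : 'End(V)) := 2^-1 *: (Z + (Y \o Y)%VF).
pose Y k := iter k step 0.
have YZ k : vnorm (Y k) <= vnorm Z.
  elim: k => [|k IH]; first by rewrite vnorm0 vnorm_ge0.
  rewrite /= /step vnormZ ger0_norm ?invr_ge0//.
  have := vnorm_triangle Z (Y k \o Y k)%VF; have := KE (Y k) (Y k).
  have : K * vnorm (Y k) * vnorm (Y k) <= K * vnorm Z * vnorm Z.
    by rewrite -!mulrA ler_wpM2l// ler_pM ?vnorm_ge0.
  have : K * vnorm Z * vnorm Z <= 2^-1 * vnorm Z by rewrite ler_wpM2r ?vnorm_ge0.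
  by have := vnorm_ge0 Z; lra.
have YS k : vnorm (Y k.+1 - Y k) <= vnorm Z / 2 ^+ k.
  elim: k => [|k IH].
    by rewrite subr0 expr0 divr1; exact: (YZ 1%N).
  (* The difference of the squares is Y'(Y' - Y) + (Y' - Y)Y, a form that does not require the two
     iterates to commute. *)
  have -> : Y k.+2 - Y k.+1 = 2^-1 *: ((Y k.+1 \o (Y k.+1 - Y k)) +
      ((Y k.+1 - Y k) \o Y k))%VF.
    rewrite [Y k.+2]/(step (Y k.+1)) [X in _ - X]/(step (Y k)) /step -scalerBr; congr (_ *: _).
    rewrite opprD addrACA subrr add0r.
    by rewrite comp_lfunDr comp_lfunDl comp_lfunNl comp_lfunNr addrA subrK.
  rewrite vnormZ ger0_norm ?invr_ge0//.
  set D := Y k.+1 - Y k.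
  have := vnorm_triangle (Y k.+1 \o D)%VF (D \o Y k)%VF.
  have := KE (Y k.+1) D; have := KE D (Y k).
  have : K * vnorm (Y k.+1) * vnorm D <= 2^-1 * vnorm D.
    by rewrite ler_wpM2r ?vnorm_ge0// (le_trans _ ZK)// ler_wpM2l.
  have : K * vnorm D * vnorm (Y k) <= 2^-1 * vnorm D.
    by rewrite mulrAC ler_wpM2r ?vnorm_ge0// (le_trans _ ZK)// ler_wpM2l.
  move: IH; rewrite -/D exprS invfM mulrCA; set t := _ / 2 ^+ k; lra.
have [L YL _] := geometric_vlim YS.
have YL1 : vlim \oo (fun k => Y k.+1) L.
  by move=> f; have := YL f; rewrite -(cvg_shiftS (fun k => f (Y k) : R)).
have LE : L = step L.
  apply: vlim_uniq YL1 _; apply: vlimZ; apply: vlimD; first exact: vlim_cst.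
  exact: vlim_comp.
have LL : (L \o L)%VF = 2 *: L - Z.
  by rewrite {3}LE /step scalerA divff// scale1r addrC addKr.
have ZS x : S x = x - Z x by rewrite /Z add_lfunE opp_lfunE id_lfunE opprB addrC subrK.
(* Kernels are closed: what is linear and holds for every iterate holds for the limit. Commutation
   with [J] and symmetry for [B] both have this form. *)
have lin_closed (W : vectType R) (f : 'Hom('End(V), W)) : (forall k, f (Y k) = 0) -> f L = 0.
  move=> fY; have := vlim_lin (L := f) YL.
  rewrite (_ : f \o Y = fun=> 0); last by apply/funext => k /=.
  move=> fL; exact: vlim_uniq fL (@vlim_cst _ _ \oo _ _ 0).
exists (\1%VF - L); split.
- apply/lfunP => x; rewrite comp_lfunE ZS; clearbody Z; rewrite !(add_lfunE, opp_lfunE, id_lfunE) linearB /=.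
  have /lfunP/(_ x) := LL; rewrite comp_lfunE add_lfunE opp_lfunE scale_lfunE => ->.
  rewrite scaler_nat mulr2n; move: (L x) (Z x) => b z.
  by rewrite opprB [b + b - z - b]addrAC addrK addrA subrK.
- rewrite addrAC subrr add0r vnormN -[L]subr0.
  by apply: vlim_le YL _; apply: nearW => k; rewrite subr0.
- move=> J SJ; have ZJ : (Z \o J)%VF = (J \o Z)%VF.
    by rewrite /Z comp_lfunDl comp_lfunDr comp_lfunNl comp_lfunNr SJ comp_lfun1l comp_lfun1r.
  have YJ k : (Y k \o J)%VF = (J \o Y k)%VF.
    elim: k => [|k IH]; first by rewrite comp_lfun0l comp_lfun0r.
    rewrite /= /step -comp_lfunZl -comp_lfunZr; congr (_ *: _).
    by rewrite comp_lfunDl comp_lfunDr ZJ -comp_lfunA IH comp_lfunA IH comp_lfunA.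
  have fl : linear (fun A : 'End(V) => (A \o J)%VF - (J \o A)%VF).
    move=> a A B; rewrite comp_lfunDl comp_lfunDr -comp_lfunZl -comp_lfunZr.
    by rewrite opprD addrACA scalerBr.
  have := lin_closed _ (linfun (fun A : 'End(V) => (A \o J)%VF - (J \o A)%VF)).
  rewrite (linfunE fl) => LJ.
  rewrite comp_lfunDl comp_lfunDr comp_lfunNl comp_lfunNr comp_lfun1l comp_lfun1r.
  congr (_ - _); apply/eqP; rewrite -subr_eq0; apply/eqP/LJ => k.
  by rewrite (linfunE fl) YJ subrr.
- move=> B SB; have ZB x y : B (Z x) y = B x (Z y).
    by rewrite /Z !(add_lfunE, opp_lfunE, id_lfunE) !linearB /= !(add_lfunE, opp_lfunE) SB.
  clearbody Z; have YB k x y : B (Y k x) y = B x (Y k y).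
    elim: k x y => [|k IH] x y; first by rewrite /= !zero_lfunE !linear0 zero_lfunE.
    rewrite /= /step !(scale_lfunE, add_lfunE, comp_lfunE) !linearZ /= scale_lfunE.
    by congr (_ *: _); rewrite !linearD /= add_lfunE ZB !IH.
  move=> x y.
  have fl : linear (fun A : 'End(V) => B (A x) y - B x (A y) : R^o).
    move=> a A A'; rewrite !(add_lfunE, scale_lfunE) bil_linl bil_linr.
    by rewrite opprD addrACA -mulrBr.
  have := lin_closed _ (linfun (fun A : 'End(V) => B (A x) y - B x (A y) : R^o)).
  rewrite (linfunE fl) => LB.
  rewrite !(add_lfunE, opp_lfunE, id_lfunE) !linearB /= !(add_lfunE, opp_lfunE).
  congr (_ - _); apply/eqP; rewrite -subr_eq0; apply/eqP/LB => k.
  by rewrite (linfunE fl) YB subrr.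
Qed.

End Perturbation.

(** * Ordinary differential equations *)

Section Picard.
Variable R : realType.
Implicit Types V W : vectType R.
Notation leb := (@lebesgue_measure R).

Lemma antiderivative (f : R -> R) (a b : R) :
  (forall x, a < x < b -> {for x, continuous f}) ->
  leb.-integrable `]a, b[ (EFin \o f) ->
  forall t, a < t < b ->
    is_derive t (1 : R) (fun y => (\int[leb]_(s in `]a, y]) f s)%R) (f t).
Proof.
move=> fc fi t /andP[at_ tb].
(* The fundamental theorem of calculus is applied on ]a, u], where t is interior and u still lies
   below b. *)
pose u := (t + b) / 2.
have tu : t < u by rewrite /u; lra.
have ub : u < b by rewrite /u; lra.
have fiu : leb.-integrable `]a, u] (EFin \o f).
  apply: integrableS fi => //.
  by apply: subset_itvl; rewrite bnd_simp.
have at' : (BRight a < BRight t)%O by rewrite bnd_simp.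
have tab : a < t < b by rewrite at_.
have [dF <-] := @continuous_FTC1 _ f (BRight a) t u tu fiu at' (fc t tab).
by rewrite derive1E; apply: DeriveDef.
Qed.

Lemma continuous_itv_measurable (f : R -> R) (a b : R) :
  (forall x, a < x < b -> {for x, continuous f}) -> measurable_fun `]a, b[ f.
Proof.
move=> fc; apply: measurable_realfun.open_continuous_measurable_fun; first exact: interval_open.
by move=> x; rewrite inE /= in_itv/=; exact: fc.
Qed.

Lemma bounded_antiderivative (f : R -> R) (a b M : R) :
  (forall x, a < x < b -> {for x, continuous f}) ->
  (forall x, a < x < b -> `|f x| <= M) ->
  exists G : R -> R, forall t, a < t < b -> is_derive t (1 : R) G (f t).
Proof.
move=> fc fM; exists (fun y => (\int[leb]_(s in `]a, y]) f s)%R).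
apply: antiderivative => //.
apply: measurable_bounded_integrable => //.
- by rewrite /= lebesgue_measure_itv/=; case: ifP => // _; rewrite -EFinB ltry.
- exact: continuous_itv_measurable.
- exists M; split; first by rewrite num_real.
  move=> x Mx y /=; rewrite in_itv/= => /fM yM.
  by rewrite (le_trans yM)// ltW.
Qed.

(** The total integral bounds the partial integrals of a nonnegative function. This bounded
    primitive is all that later arguments retain of the finiteness of the integral. *)
Lemma integral_antiderivative (f : R -> R) (a b : R) :
  (forall x, a < x < b -> {for x, continuous f}) ->
  (forall x, a < x < b -> 0 <= f x) ->
  (\int[leb]_(t in `]a, b[) (f t)%:E < +oo)%E ->
  exists (G : R -> R) (M : R), forall t, a < t < b ->
    is_derive t (1 : R) G (f t) /\ `|G t| <= M.
Proof.
move=> fc f0 fi.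
have mf := continuous_itv_measurable fc.
have intf : leb.-integrable `]a, b[ (EFin \o f).
  apply/integrableP; split; first exact/measurable_realfun.measurable_EFinP.
  rewrite (_ : (\int[leb]_(x in `]a, b[) `|(EFin \o f) x| =
    \int[leb]_(x in `]a, b[) (f x)%:E)%E)//.
  apply: eq_integral => x; rewrite inE/= in_itv/= => /f0 fx.
  by rewrite ger0_norm.
exists (fun y => (\int[leb]_(s in `]a, y]) f s)%R), (fine (\int[leb]_(t in `]a, b[) (f t)%:E)).
move=> t tab; split; first exact: (antiderivative fc intf).
have sub : `]a, t] `<=` `]a, b[.
  by apply: subset_itvl; rewrite bnd_simp; case/andP: tab.
have f0' x : (`]a, t]%classic : set R) x -> 0 <= f x.
  by move=> /sub/=; rewrite in_itv/=; exact: f0.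
have mt : measurable (`]a, t]%classic : set R) by [].
rewrite ger0_norm /Rintegral; last first.
  by apply: fine_ge0; apply: integral_ge0 => x /f0'; rewrite lee_fin.
apply: fine_le.
- have intt : leb.-integrable `]a, t] (EFin \o f) by apply: integrableS intf.
  exact: (integrable_fin_num _ intt).
- exact: (integrable_fin_num _ intf).
- by apply: ge0_subset_integral => //; exact/measurable_realfun.measurable_EFinP.
Qed.

Lemma vder_mean_center V (c d : R -> V) (T r K : R) : 0 <= K ->
  (forall x, `|x - T| < r -> vder c x (d x) /\ vnorm (d x) <= K) ->
  forall s t, `|s - T| < r -> `|t - T| < r ->
  vnorm (c t - c s) <= (\dim {:V})%:R * K * `|t - s|.
Proof.
move=> K0 cd.
suff H s t : s <= t -> `|s - T| < r -> `|t - T| < r ->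
    vnorm (c t - c s) <= (\dim {:V})%:R * K * `|t - s|.
  move=> s t sr tr; have [st|/ltW ts] := leP s t; first exact: H.
  by rewrite vnorm_sub distrC; exact: H.
move=> st; rewrite !ltr_norml => sr tr.
rewrite (ger0_norm (_ : 0 <= t - s)) ?subr_ge0//.
apply: (vder_mean (d := d)) => // x /andP[sx xt]; apply: cd.
by rewrite ltr_norml; lra.
Qed.

Section GlobalLipschitz.
Variables (V : vectType R) (F : V -> V) (L M : R) (x0 : V) (T : R).
Hypotheses (L0 : 0 <= L) (M0 : 0 <= M).
Hypothesis FL : forall x y, vnorm (F x - F y) <= L * vnorm (x - y).
Hypothesis FM : forall x, vnorm (F x) <= M.
Let N : R := (\dim {:V})%:R.
(** The factor N is the loss in the coordinatewise mean value theorem. On this radius one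
    integration of a difference of fields at least halves a uniform bound, see [delL]. *)
Let del : R := (2 * (N * L + 1))^-1.
Let I (t : R) := `|t - T| < del.

Let N0 : 0 <= N. Proof. exact: ler0n. Qed.
Let del0 : 0 < del.
Proof. by rewrite /del invr_gt0 mulr_gt0// ltr_wpDl// mulr_ge0. Qed.
Let IT : I T. Proof. by rewrite /I subrr normr0. Qed.
Let delL (K t : R) : 0 <= K -> I t -> N * (L * K) * `|t - T| <= K / 2.
Proof.
move=> K0 /ltW It; rewrite (@le_trans _ _ (N * (L * K) * del))//.
  by rewrite ler_wpM2l ?mulr_ge0.
have P0 : 0 < 2 * (N * L + 1) by rewrite mulr_gt0// ltr_wpDl// mulr_ge0.
rewrite /del ler_pdivrMr//.
by have := mulr_ge0 (mulr_ge0 N0 L0) K0; nra.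
Qed.

Let primitive (h c : R -> V) := c T = x0 /\ forall t, I t -> vder c t (F (h t)).
Let cont (h : R -> V) := forall t, I t -> vlim (nbhs t) h (h t).

Let primitive_cont h c : primitive h c -> cont c.
Proof. by move=> [_ hc] t /hc; exact: vder_vlim. Qed.

Let primitive_ex h : cont h -> exists c, primitive h c.
Proof.
move=> hc.
have IE t : I t <-> T - del < t < T + del.
  by rewrite /I ltr_norml; split=> /andP[? ?]; apply/andP; split; lra.
have Flip x : vlip F x by exists 1, L; split.
have /choice[G GP] (i : 'I_(\dim {:V})) : exists G : R -> R,
    forall t, T - del < t < T + del -> is_derive t (1 : R) G (vcoord i (F (h t)) : R).
  apply: (@bounded_antiderivative _ _ _ M) => t /IE It.
    have lim : vlim (nbhs t) (F \o h) (F (h t)) by apply: vlip_vlim (Flip _) (hc t It).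
    exact: lim.
  by rewrite (le_trans (vcoord_le _ _)).
exists (fun t => x0 + \sum_i (G i t - G i T) *: vb i); split.
  by rewrite big1 ?addr0// => i _; rewrite subrr scale0r.
move=> t /IE It; rewrite -[F (h t)]add0r; apply: vderD; first exact: vder_cst.
apply: vder_coord => i; under eq_fun do rewrite vcoord_vecof.
rewrite -[X in is_derive _ _ _ X]subr0; apply: is_deriveB.
exact: GP.
Qed.

(** A primitive is chosen arbitrarily; the default is never taken on the iterates, since they stay
    continuous and [primitive_ex] applies. *)
Let next h := xget (fun=> x0) [set c | primitive h c].
Let iterate k := iter k next (fun=> x0).

Let iterate_cont k : cont (iterate k).
Proof.
elim: k => [|k IH]; first by move=> t _; exact: vlim_cst.
have [c hc] := primitive_ex IH.
by apply: (@primitive_cont (iterate k)); exact: (xgetI _ hc).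
Qed.

Let iterateP k : primitive (iterate k) (iterate k.+1).
Proof. by have [c hc] := primitive_ex (@iterate_cont k); exact: (xgetI _ hc). Qed.

Let iterateT k : iterate k T = x0.
Proof. by case: k => [//|k]; case: (iterateP k). Qed.

Let C := N * M * del.
Let C0 : 0 <= C. Proof. by rewrite !mulr_ge0// ltW. Qed.

Let iterate_lip k s t : I s -> I t ->
  vnorm (iterate k t - iterate k s) <= N * M * `|t - s|.
Proof.
case: k => [_ _|k Is It]; first by rewrite subrr vnorm0 !mulr_ge0.
apply: (vder_mean_center (d := fun x => F (iterate k x)) (T := T) (r := del)) => //.
by move=> x Ix; split=> //; exact: (iterateP k).2.
Qed.

Let iterate_step k t : I t -> vnorm (iterate k.+1 t - iterate k t) <= C / 2 ^+ k.
Proof.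
elim: k t => [|k IH] t It.
  rewrite expr0 divr1 [iterate 0 t](_ : _ = iterate 1 T); last by rewrite iterateT.
  rewrite (le_trans (iterate_lip 1 IT It))//.
  by rewrite /C ler_wpM2l ?mulr_ge0//; exact: ltW It.
pose e s := iterate k.+2 s - iterate k.+1 s.
have -> : iterate k.+2 t - iterate k.+1 t = e t - e T.
  by rewrite /e !iterateT subrr subr0.
have Ck : 0 <= C / 2 ^+ k by rewrite divr_ge0// exprn_ge0.
apply: (@le_trans _ _ (N * (L * (C / 2 ^+ k)) * `|t - T|)).
  apply: (vder_mean_center (d := fun x => F (iterate k.+1 x) - F (iterate k x))
    (T := T) (r := del)) => // [|x Ix]; first by rewrite mulr_ge0.
  split.
    by apply: vderD; [exact: (iterateP k.+1).2|apply: vderN; exact: (iterateP k).2].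
  by rewrite (le_trans (FL _ _))// ler_wpM2l// IH.
by rewrite (le_trans (delL Ck It))// exprS invfM [_^-1 * _]mulrC mulrA.
Qed.

Lemma picard_global : exists2 d : R, 0 < d &
  exists c : R -> V, c T = x0 /\ forall t, `|t - T| < d -> vder c t (F (c t)).
Proof.
exists del => //.
have /choice[l lP] t : exists l, I t -> vlim \oo (iterate^~ t) l /\
    forall k, vnorm (l - iterate k t) <= N * (2 * C / 2 ^+ k).
  have [It|nIt] := pselect (I t); last by exists 0.
  have [l lim lb] := geometric_vlim (fun k => iterate_step k It).
  by exists l.
(* The iterates share the Lipschitz constant N M, which survives in the pointwise limit. *)
have l_cont : cont l.
  move=> t It; apply: (@vlim_squeeze _ _ (nbhs t) _ _ _ _ (fun s => N * M * `|s - t|)).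
    rewrite -[X in _ --> X](mulr0 (N * M)); apply: cvgM; first exact: cvg_cst.
    have -> : (0 : R) = `|t - t| by rewrite subrr normr0.
    by apply: cvg_norm; apply: cvgB; [exact: cvg_id|exact: cvg_cst].
  have : \forall s \near t, I s.
    have /cvgr_dist_lt/(_ del) : (fun s : R => s - T) @ t --> t - T.
      by apply: cvgB; [exact: cvg_id|exact: cvg_cst].
    have e0 : 0 < del - `|t - T| by rewrite subr_gt0.
    move=> _; have := nbhsx_ballx t _ e0; apply: filterS => s /= ts.
    rewrite /I -(subrK t s) -addrA (le_lt_trans (ler_normD _ _))//.
    by rewrite distrC -ltrBrDr.
  apply: filterS => s Is; rewrite -[l s - l t]subr0.
  apply: (@vlim_le _ _ \oo _ _ (fun k => iterate k s - iterate k t)).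
    by apply: vlimB; [exact: (lP s Is).1|exact: (lP t It).1].
  by apply: nearW => k; rewrite subr0 iterate_lip.
(* Let G be the primitive of F along l. The shifted iterates converge both to G and to l, so l
   itself solves the equation. *)
have [G [GT GP]] := primitive_ex l_cont.
suff Gl t : I t -> G t = l t.
  by exists G; split=> // t It; rewrite Gl//; exact: GP.
move=> It; apply: (@vlim_uniq _ _ \oo _ _ (fun k => iterate k.+1 t)); last first.
  move=> f; have := (lP t It).1 f.
  by rewrite -(cvg_shiftS (fun k => f (iterate k t) : R)).
apply: (@vlim_squeeze _ _ \oo _ _ _ _ (fun k => N * (2 * C / 2 ^+ k))).
  rewrite -[X in _ --> X](mulr0 N); apply: cvgM; first exact: cvg_cst.
  have -> : (fun k => 2 * C / 2 ^+ k) = geometric (2 * C) (2^-1 : R).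
    by apply/funext => k; rewrite /geometric /= exprVn.
  by apply: cvg_geometric; rewrite ger0_norm ?invr_ge0// invf_lt1 ?ltr1n.
apply: nearW => k; rewrite vnorm_sub.
pose e s := G s - iterate k.+1 s.
have -> : G t - iterate k.+1 t = e t - e T.
  by rewrite /e GT iterateT subrr subr0.
set K := N * (2 * C / 2 ^+ k).
have K0 : 0 <= K by rewrite /K mulr_ge0// divr_ge0// ?exprn_ge0// mulr_ge0.
apply: (@le_trans _ _ (N * (L * K) * `|t - T|)).
  apply: (vder_mean_center (d := fun x => F (l x) - F (iterate k x))
    (T := T) (r := del)) => // [|x Ix]; first by rewrite mulr_ge0.
  split.
    by apply: vderD; [exact: GP|apply: vderN; exact: (iterateP k).2].
  by rewrite (le_trans (FL _ _))// ler_wpM2l//; exact: (lP x Ix).2.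
rewrite (le_trans (delL K0 It))//; lra.
Qed.

End GlobalLipschitz.

(* Coordinatewise truncation to a box around x0 turns a locally Lipschitz field
   into a globally Lipschitz bounded one. *)
Lemma picard V (F : V -> V) (x0 : V) (T : R) : vlip F x0 ->
  exists2 d : R, 0 < d &
  exists c : R -> V, c T = x0 /\ forall t, `|t - T| < d -> vder c t (F (c t)).
Proof.
move=> /vlip_bound[r [L [M [r0 L0 M0 FM FL]]]].
pose N : R := (\dim {:V})%:R.
have N10 : 0 < N + 1 by rewrite ltr_wpDl// ler0n.
(* A box of half-side [rho] has l1 radius N rho <= r, so truncated points stay where F is Lipschitz;
   N + 1 avoids dividing by zero in dimension 0. *)
pose rho := r / (N + 1).
have rho0 : 0 < rho by rewrite divr_gt0.
pose clamp (a x : R) := Num.max (a - rho) (Num.min (a + rho) x).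
have clampL a x y : `|clamp a x - clamp a y| <= `|x - y|.
  rewrite /clamp /Num.max /Num.min ler_norml.
  have [] := leP 0 (x - y) => H; [rewrite ger0_norm//|rewrite ltr0_norm//];
  do ![case: ifPn => /=]; rewrite -?leNgt => *; apply/andP; split; lra.
have clampR a x : `|clamp a x - a| <= rho.
  rewrite /clamp /Num.max /Num.min ler_norml.
  do ![case: ifPn => /=]; rewrite -?leNgt => *; apply/andP; split; lra.
have clampE a x : `|x - a| <= rho -> clamp a x = x.
  rewrite /clamp /Num.max /Num.min ler_norml => /andP[? ?].
  do ![case: ifPn => /=]; rewrite -?leNgt => *; lra.
pose pr (x : V) : V := \sum_i clamp (vcoord i x0) (vcoord i x) *: vb i.
have prL x y : vnorm (pr x - pr y) <= vnorm (x - y).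
  by apply: ler_sum => i _; rewrite !linearB /= !vcoord_vecof.
have prR x : vnorm (pr x - x0) <= r.
  apply: (@le_trans _ _ (N * rho)).
    rewrite mulr_natl -[X in _ *+ X]card_ord -sumr_const; apply: ler_sum => i _.
    by rewrite linearB /= vcoord_vecof.
  by rewrite /rho mulrCA ger_pMr// ler_pdivrMr// mul1r lerDl.
have prE x : vnorm (x - x0) <= rho -> pr x = x.
  move=> xr; apply: vcoord_eq => i; rewrite vcoord_vecof clampE//.
  by rewrite (le_trans _ xr)// -linearB; exact: vcoord_le.
have [||d d0 [c [cT cP]]] := @picard_global V (F \o pr) L M x0 T L0 M0.
- by move=> x y; rewrite /= (le_trans (FL _ _ _ _))// ler_wpM2l.
- by move=> x; exact: FM.
(* By continuity the solution stays for a short time in the ball where truncation is the identity,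
   and there it solves the original equation. *)
have [e /= e0 eP] : exists2 e : R, 0 < e & forall t, `|t - T| < e -> vnorm (c t - x0) <= rho.
  have := vder_vlim (cP T _); rewrite subrr normr0 cT => /(_ d0).
  move=> /vlim_norm /(_ rho0)/nbhs_ballP[e /= e0 eP]; exists e => // t te.
  by apply: ltW; apply: eP; rewrite /ball/= distrC.
exists (Num.min d e); first by rewrite lt_min d0.
exists c; split=> // t; rewrite lt_min => /andP[td te].
by have := cP t td; rewrite /= prE//; exact: eP.
Qed.

End Picard.

(** * Maps of class C^1 are locally Lipschitz *)

Section SmoothLipschitz.
Variable R : realType.
Implicit Types V W : vectType R.

Lemma to_coordE V (v : V) i : to_coord v 0 i = vcoord i v.
Proof. by rewrite /to_coord mxE vcoordE. Qed.

Lemma is_derive_line n m (g : 'rV[R]_n -> 'rV[R]_m) (z e : 'rV[R]_n) (s : R) j :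
  derivable g (z + s *: e) e ->
  is_derive s (1 : R) (fun u => g (z + u *: e) 0 j) ('D_e g (z + s *: e) 0 j).
Proof.
move=> dg.
have lim : (fun h : R => h^-1 *: (g (z + (h *: (1 : R^o) + s) *: e) 0 j - g (z + s *: e) 0 j : R^o))
    @ (0 : R)^' --> ('D_e g (z + s *: e) 0 j : R).
  have := cvg_comp _ _ dg (@coord_continuous _ 1 m 0 j _).
  apply: cvg_trans; apply: near_eq_cvg; apply: nearW => h /=.
  by rewrite !mxE -[h *: 1]/(h * 1) mulr1 scalerDl addrCA.
split; first by apply/cvg_ex; eexists; exact: lim.
by apply/cvg_lim; [exact: Rhausdorff|exact: lim].
Qed.

(** The partial derivatives are bounded near [u0] by continuity. Passing from y to x one coordinate
    at a time, each move stays in the box and involves a single partial derivative, to which the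
    scalar mean value theorem applies. *)
Lemma Ck1_lip n m (O : set 'rV[R]_n) (g : 'rV[R]_n -> 'rV[R]_m) u0 :
  open O -> O u0 -> Ck_on 1 O g ->
  exists r K : R, [/\ 0 < r, 0 <= K & forall x y : 'rV[R]_n,
    (forall i, `|x 0 i - u0 0 i| < r) -> (forall i, `|y 0 i - u0 0 i| < r) ->
    forall j, `|g x 0 j - g y 0 j| <= K * \sum_i `|x 0 i - y 0 i|].
Proof.
move=> oO Ou0 [_ Dg].
pose e (i : 'I_n) : 'rV[R]_n := delta_mx 0 i.
pose K0 (i : 'I_n) (j : 'I_m) : R := `|'D_(e i) g u0 0 j| + 1.
have near_i : \forall u \near u0, O u /\ forall i j, `|'D_(e i) g u 0 j| <= K0 i j.
  apply: filterI; first exact: (open_nbhs_nbhs (conj oO Ou0)).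
  apply: (@filter_forall _ _ _ (nbhs u0) _) => i.
  apply: (@filter_forall _ _ _ (nbhs u0) _) => j.
  have [_ [cD _]] := Dg (e i).
  have lim : (fun u => 'D_(e i) g u 0 j : R) @ u0 --> ('D_(e i) g u0 0 j : R).
    exact: (cvg_comp _ _ (cD u0 Ou0) (@coord_continuous _ 1 m 0 j _)).
  move/cvgr_dist_lt : lim => /(_ 1 ltr01); apply: filterS => u /= ul.
  rewrite /K0 -[X in `|X| <= _](subrK ('D_(e i) g u0 0 j)) addrC.
  by rewrite (le_trans (ler_normD _ _))// lerD2l distrC ltW.
have /nbhs_ballP[r /= r0 rP] := near_i.
pose K : R := \sum_(i < n) \sum_(j < m) K0 i j.
have K00 i j : 0 <= K0 i j by rewrite addr_ge0.
exists r, K; split=> // [|x y xr yr j]; first by apply: sumr_ge0 => i _; apply: sumr_ge0.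
have inO (u : 'rV[R]_n) : (forall i, `|u 0 i - u0 0 i| < r) ->
    O u /\ forall i j, `|'D_(e i) g u 0 j| <= K0 i j.
  move=> ur; apply: rP; split=> // a b; rewrite (ord1 a) /ball /= distrC; exact: ur.
pose z k : 'rV[R]_n := \row_i (if (i < k)%N then x 0 i else y 0 i).
have zr k i : `|z k 0 i - u0 0 i| < r by rewrite mxE; case: ifP.
have zS (k : 'I_n) : `|g (z k.+1) 0 j - g (z k) 0 j| <= K * `|x 0 k - y 0 k|.
  pose a := x 0 k - y 0 k.
  have zkE : z k.+1 = z k + a *: e k.
    apply/rowP => i; rewrite !mxE eqxx /= ltnS leq_eqVlt -val_eqE eq_sym.
    case: eqVneq => [/ord_inj<-|_] /=; last by rewrite mulr0 addr0.
    by rewrite ltnn mulr1 /a addrC subrK.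
  pose phi (s : R) := g (z k + s *: e k) 0 j.
  have line (s : R) : 0 <= s <= 1 -> forall i, `|(z k + (s * a) *: e k) 0 i - u0 0 i| < r.
    move=> /andP[s0 s1] i; rewrite !mxE eqxx /=.
    case: eqVneq => [->|_]; rewrite ?ltnn ?mulr0 ?addr0; last by case: ifP.
    rewrite mulr1 /a.
    have mr : Num.max `|x 0 k - u0 0 k| `|y 0 k - u0 0 k| < r by rewrite gt_max xr yr.
    have /andP[mx my] : (`|x 0 k - u0 0 k| <= Num.max `|x 0 k - u0 0 k| `|y 0 k - u0 0 k|) &&
      (`|y 0 k - u0 0 k| <= Num.max `|x 0 k - u0 0 k| `|y 0 k - u0 0 k|).
      by rewrite !le_max !lexx orbT.
    rewrite (_ : y 0 k + _ - _ = (1 - s) * (y 0 k - u0 0 k) + s * (x 0 k - u0 0 k)); last by ring.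
    rewrite (le_lt_trans (ler_normD _ _))// !normrM (ger0_norm s0) ger0_norm ?subr_ge0//.
    by apply: le_lt_trans mr; nra.
  have dphi (s : R) : 0 <= s <= 1 -> is_derive s (1 : R) (fun s => phi (s * a))
      ('D_(e k) g (z k + (s * a) *: e k) 0 j * a).
    move=> s01; have [Os _] := inO _ (line s s01).
    have d1 := @is_derive_line _ _ g (z k) (e k) (s * a) j ((Dg (e k)).1 _ Os).
    have d2 : is_derive s (1 : R) (fun s : R => s * a) a.
      apply: (is_derive_eq (is_deriveM (is_derive_id s (1 : R)) (is_derive_cst a s (1 : R)))).
      by rewrite scaler0 add0r -[_ *: _]/(a * 1) mulr1.
    exact: (@is_derive1_comp _ phi (fun s => s * a) s _ a d1 d2).
  have [s /andP[s0 s1]] := MVT_open (ltr01 : (0 : R) < 1) dphi.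
  rewrite subr0 mulr1 mul1r mul0r /phi scale0r addr0 -zkE => ->.
  have s01 : 0 <= s <= 1 by rewrite !ltW.
  rewrite normrM ler_wpM2r// (le_trans ((inO _ (line s s01)).2 k j))//.
  rewrite /K (bigD1 k)//= (bigD1 j)//= -addrA lerDl addr_ge0 ?sumr_ge0// => *.
  by rewrite sumr_ge0.
have zk k : (k <= n)%N -> `|g (z k) 0 j - g y 0 j| <= K * \sum_(i < n | (i < k)%N) `|x 0 i - y 0 i|.
  elim: k => [|k IH] kn.
    rewrite (_ : z 0%N = y); last by apply/rowP => i; rewrite mxE.
    by rewrite subrr normr0 big_pred0 ?mulr0.
  rewrite (bigD1 (Ordinal kn))//= mulrDr -(subrK (g (z k) 0 j) (g (z k.+1) 0 j)) -addrA.
  rewrite (le_trans (ler_normD _ _))// lerD//; first exact: (zS (Ordinal kn)).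
  rewrite (le_trans (IH (ltnW kn)))// (eq_bigl (fun i : 'I_n => (i < k)%N))// => i.
  by rewrite ltnS ltn_neqAle andbC.
have := zk n (leqnn n); rewrite (_ : z n = x).
  rewrite (_ : \sum_(i < n | (i < n)%N) `|x 0 i - y 0 i| = \sum_i `|x 0 i - y 0 i|)//.
  by apply: eq_bigl => i; rewrite ltn_ord.
by apply/rowP => i; rewrite mxE ltn_ord.
Qed.

(** Only the first-order part of smoothness is needed. The l1 ball of radius r/2 sits inside the
    open box of radius r, which absorbs the strict inequalities. *)
Lemma smooth_vlip V W (U : set V) (f : V -> W) x0 :
  vect_open U -> U x0 -> smooth_on U f -> vlip f x0.
Proof.
move=> oU Ux0 /(_ 1%N) sf.
have oc (x : V) : of_coord (to_coord x) = x by exact: passmx.rVofK (vbasisP _) x.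
have [|r [K [r0 K0 gK]]] := Ck1_lip (u0 := to_coord x0) oU _ sf; first by rewrite /= oc.
exists (r / 2), ((\dim {:W})%:R * K); split; [by rewrite divr_gt0|by rewrite mulr_ge0 ?ler0n|].
have near_r x : vnorm (x - x0) <= r / 2 -> forall i, `|to_coord x 0 i - to_coord x0 0 i| < r.
  move=> xr i; rewrite !to_coordE -linearB.
  by rewrite (le_lt_trans (vcoord_le _ _))// (le_lt_trans xr)// ltr_pdivrMr// mulr_natr mulr2n ltrDl.
move=> x y /near_r xr /near_r yr.
rewrite -mulrA mulr_natl -[X in _ *+ X]card_ord -sumr_const; apply: ler_sum => j _.
have := gK _ _ xr yr j; rewrite /= !oc !to_coordE linearB /= => /le_trans; apply.
rewrite ler_wpM2l// le_eqVlt; apply/orP; left; apply/eqP; apply: eq_bigr => i _.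
by rewrite !to_coordE linearB.
Qed.

End SmoothLipschitz.

(** * Almost-hermitian pairs and unitary frames *)

Section InnerProducts.
Variables (R : realType) (V : vectType R).
Implicit Types (B w g : bilform R V) (h k A J : 'End(V)) (mu : bimap V V).

Lemma bilDl B x y z : B (x + y) z = B x z + B y z :> R.
Proof. by rewrite linearD add_lfunE. Qed.
Lemma bilDr B x y z : B x (y + z) = B x y + B x z :> R.
Proof. by rewrite linearD. Qed.
Lemma bilNl B x y : B (- x) y = - B x y :> R.
Proof. by rewrite linearN opp_lfunE. Qed.
Lemma bilNr B x y : B x (- y) = - B x y :> R.
Proof. by rewrite linearN. Qed.
Lemma bilZl B a x y : B (a *: x) y = a * B x y :> R.
Proof. by rewrite linearZ /= scale_lfunE. Qed.
Lemma bilZr B a x y : B x (a *: y) = a * B x y :> R.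
Proof. by rewrite linearZ. Qed.

Lemma alt2_anti (W : vectType R) (B : bimap V W) x y : B \in alt2 V W -> B x y = - B y x.
Proof.
rewrite memv_ker lfunE /= => /eqP/lfunP/(_ x)/lfunP/(_ y).
by rewrite /symmetrize !add_lfunE flipE !zero_lfunE => /eqP; rewrite addr_eq0 => /eqP.
Qed.

Lemma pos_nondeg g : (forall x, x != 0 -> (0 : R) < g x x) -> Defs.nondegenerate g.
Proof.
move=> g0 x gx; apply/eqP; apply: contraT => /g0.
by rewrite gx ltxx.
Qed.

Lemma inner_ge0 g x : (forall x, x != 0 -> (0 : R) < g x x) -> (0 : R) <= g x x.
Proof.
move=> g0; have [->|/g0/ltW//] := eqVneq x 0.
by rewrite linear0.
Qed.

Lemma lker0_inj h x : lker h == 0%VS -> h x = 0 -> x = 0.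
Proof. by move=> /lker0P hi hx; apply: hi; rewrite hx linear0. Qed.

Lemma lker0_neq0 h x : lker h == 0%VS -> x != 0 -> h x != 0.
Proof. by move=> hk; apply: contra_neq; exact: lker0_inj. Qed.

Lemma lker0_bij h : lker h == 0%VS -> bijective h.
Proof. by move=> h0; exists (h^-1)%VF; [exact: lker0_lfunK|exact: lker0_lfunVK]. Qed.

Section AlmostHermitianPair.
Variables (w g : bilform R V).
Hypothesis H : almost_hermitian w g.
Let J := Jop w g.

Lemma ah_gnd : Defs.nondegenerate g.
Proof. by apply: pos_nondeg; case: H. Qed.

Lemma ah_JE x y : g (J x) y = w x y.
Proof. by rewrite /J /Jop form_opE//; exact: ah_gnd. Qed.

Lemma ah_JJ x : J (J x) = - x.
Proof.
by have /lfunP/(_ x) := ah_J H; rewrite comp_lfunE opp_lfunE id_lfunE.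
Qed.

Lemma ah_Jskew x y : g (J x) y = - g x (J y) :> R.
Proof.
by rewrite (ah_sym H x) !ah_JE (alt2_anti _ _ (ah_alt H)).
Qed.

Lemma ah_Jiso x y : g (J x) (J y) = g x y.
Proof. by rewrite ah_Jskew ah_JJ bilNr opprK. Qed.

End AlmostHermitianPair.

(** An orthogonal complex structure makes [w] alternating and nondegenerate by itself, so a pullback
    only has to conjugate [J]. *)
Lemma ah_intro w g J : Defs.symmetric_form g ->
  (forall x, x != 0 -> (0 : R) < g x x) ->
  (forall x, J (J x) = - x) -> (forall x y, g (J x) (J y) = g x y) ->
  (forall x y, w x y = g (J x) y) ->
  almost_hermitian w g /\ Jop w g = J.
Proof.
move=> gs gp JJ Ji wE; have gnd := pos_nondeg gp.
have JE : Jop w g = J.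
  by apply/lfunP => x; apply: (nondeg_eq gnd) => y; rewrite form_opE.
have wskew x y : w x y = - w y x.
  by rewrite !wE -(Ji (J x)) JJ bilNl (gs x).
split=> //; split=> //.
- by apply/alt2P => x; have := wskew x x; move: (w x x : R) => a; lra.
- move=> x wx; have Jx : J x = 0 by apply: gnd => y; rewrite -wE wx.
  by have := JJ x; rewrite Jx linear0 => /esym/eqP; rewrite oppr_eq0 => /eqP.
- by rewrite JE; apply/lfunP => x; rewrite comp_lfunE JJ opp_lfunE id_lfunE.
Qed.

Definition pullback (W : vectType R) (h : 'Hom(V, W)) (B : bilform R W) : bilform R V :=
  linfun (fun x => (B (h x) \o h)%VF).

Lemma pullbackE (W : vectType R) (h : 'Hom(V, W)) (B : bilform R W) x y :
  pullback h B x y = B (h x) (h y).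
Proof.
rewrite linfunE ?comp_lfunE// => a u v; apply/lfunP => z.
by rewrite !(comp_lfunE, add_lfunE, scale_lfunE, linearP).
Qed.

Lemma pullback_ah h w g : lker h == 0%VS -> almost_hermitian w g ->
  almost_hermitian (pullback h w) (pullback h g).
Proof.
move=> h0 H; have := ah_JJ H; have := ah_Jiso H; have := ah_JE H.
move: (Jop w g) => J JE Ji JJ.
apply: (@ah_intro _ _ (h^-1 \o (J \o h))%VF _ _ _ _ _).1.
- by move=> x y; rewrite !pullbackE (ah_sym H).
- by move=> x x0; rewrite pullbackE; apply: (ah_pos H); exact: lker0_neq0.
- by move=> x; rewrite !comp_lfunE lker0_lfunVK// JJ linearN /= lker0_lfunK.
- by move=> x y; rewrite !pullbackE !comp_lfunE !lker0_lfunVK// Ji.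
- by move=> x y; rewrite !pullbackE !comp_lfunE lker0_lfunVK// JE.
Qed.

(* The bracket transported by h, with k standing for the inverse of h. *)
Definition push h k mu : bimap V V := linfun (fun x => (h \o mu (k x) \o k)%VF).

Lemma pushE h k mu x y : push h k mu x y = h (mu (k x) (k y)).
Proof.
rewrite linfunE ?comp_lfunE// => a u v; apply/lfunP => z.
by rewrite !(comp_lfunE, add_lfunE, scale_lfunE, linearP).
Qed.

Lemma push_alt h k mu : mu \in alt2 V V -> push h k mu \in alt2 V V.
Proof. by move=> /alt2P m0; apply/alt2P => x; rewrite pushE m0 linear0. Qed.

Lemma push_lie h k mu : (forall x, k (h x) = x) -> lie_bracket mu ->
  lie_bracket (push h k mu).
Proof.
move=> kh [ma mj]; split; first exact: push_alt.
by move=> x y z; rewrite !pushE !kh -!linearD mj linear0.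
Qed.

End InnerProducts.

Section Frames.
Variables (R : realType) (V : vectType R) (T : Type) (F : set_system T).
Context {FF : Filter F}.
Implicit Types (w g : T -> bilform R V) (h k : T -> 'End(V)).

Lemma vlim_pullback h (h0 : 'End(V)) w (w0 : bilform R V) :
  vlim F h h0 -> vlim F w w0 -> vlim F (fun s => pullback (h s) (w s)) (pullback h0 w0).
Proof.
move=> hh ww; apply: vlim_hom => x; apply: vlim_hom => y.
rewrite pullbackE; under eq_fun do rewrite pullbackE.
apply: vlim_eval; last exact: vlim_app.
by apply: vlim_eval => //; exact: vlim_app.
Qed.

Lemma vlim_push h (h0 : 'End(V)) k (k0 : 'End(V)) (mu : bimap V V) :
  vlim F h h0 -> vlim F k k0 -> vlim F (fun s => push (h s) (k s) mu) (push h0 k0 mu).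
Proof.
move=> hh kk; apply: vlim_hom => x; apply: vlim_hom => y.
rewrite pushE; under eq_fun do rewrite pushE.
apply: vlim_eval => //; apply: vlim_eval; last exact: vlim_app.
by apply: vlim_eval; [exact: vlim_cst|exact: vlim_app].
Qed.

Lemma vlim_Jop w g (w0 g0 : bilform R V) : almost_hermitian w0 g0 ->
  (\forall s \near F, almost_hermitian (w s) (g s)) ->
  vlim F w w0 -> vlim F g g0 -> vlim F (fun s => Jop (w s) (g s)) (Jop w0 g0).
Proof.
move=> H0 H ww gg; apply: form_op_vlim => //; first exact: ah_gnd H0.
by apply: filterS H => s; exact: ah_gnd.
Qed.

(* First conjugate J to J0 by the intertwiner h1 = (1 - J0 J) / 2, then correct
   by the square root X of the g-to-(h1^* g0) transition operator, which
   commutes with J. *)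
Lemma unitary_frame w g (w0 g0 : bilform R V) : almost_hermitian w0 g0 ->
  (\forall s \near F, almost_hermitian (w s) (g s)) ->
  vlim F w w0 -> vlim F g g0 ->
  exists2 h, vlim F h \1%VF & \forall s \near F,
    [/\ lker (h s) == 0%VS, forall x y, w s x y = w0 (h s x) (h s y) &
        forall x y, g s x y = g0 (h s x) (h s y)].
Proof.
move=> H0 H ww gg.
pose J0 := Jop w0 g0; pose J s := Jop (w s) (g s).
pose h1 s : 'End(V) := 2^-1 *: (\1%VF - (J0 \o J s)%VF).
have h1E s x : h1 s x = 2^-1 *: (x - J0 (J s x)).
  by rewrite scale_lfunE add_lfunE opp_lfunE id_lfunE comp_lfunE.
have h1lim : vlim F h1 \1%VF.
  have -> : \1%VF = 2^-1 *: (\1%VF - (J0 \o J0)%VF) :> 'End(V).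
    by rewrite (ah_J H0) opprK -[X in _ *: X]mulr2n -[X in _ *: X]scaler_nat scalerA mulVf ?scale1r.
  apply: vlimZ; apply: vlimB; first exact: vlim_cst.
  by apply: vlim_comp; [exact: vlim_cst|exact: vlim_Jop].
pose G s := pullback (h1 s) g0.
have Glim : vlim F G g0.
  rewrite [g0](_ : _ = pullback \1%VF g0); last first.
    by apply/lfunP => x; apply/lfunP => y; rewrite pullbackE !id_lfunE.
  by apply: vlim_pullback => //; exact: vlim_cst.
have Gpos s : lker (h1 s) == 0%VS -> forall x, x != 0 -> (0 : R) < G s x x.
  by move=> k0 x x0; rewrite pullbackE; apply: (ah_pos H0); exact: lker0_neq0.
have ker1 : \forall s \near F, lker (h1 s) == 0%VS by exact: near_one_lker0.
pose S s := form_op (G s) (g s).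
have Slim : vlim F S \1%VF.
  have -> : \1%VF = form_op g0 g0.
    apply/lfunP => x; apply: (nondeg_eq (ah_gnd H0)) => y.
    by rewrite form_opE ?id_lfunE//; exact: ah_gnd H0.
  apply: form_op_vlim => //; first exact: ah_gnd H0.
  by apply: (@filterS _ F FF _ _ _ ker1) => s /Gpos; exact: pos_nondeg.
have [c c0 sqrtP] := lfun_sqrt V.
(* Far from the identity [X] is set to 0; those values do not matter, since S tends to 1 and |X - 1|
   <= |S - 1| eventually. *)
have /choice[X XP] s : exists X : 'End(V), vnorm (S s - \1%VF) <= c ->
  [/\ (X \o X)%VF = S s, vnorm (X - \1%VF) <= vnorm (S s - \1%VF),
    forall J, (S s \o J)%VF = (J \o S s)%VF -> (X \o J)%VF = (J \o X)%VF &
    forall B : bilform R V, (forall x y, B (S s x) y = B x (S s y)) ->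
      forall x y, B (X x) y = B x (X y)].
  have [/sqrtP[X XP]|_] := boolP (vnorm (S s - \1%VF) <= c); first by exists X.
  by exists 0.
have Sc : \forall s \near F, vnorm (S s - \1%VF) <= c.
  by apply: (@filterS _ F FF _ _ _ (vlim_norm Slim c0)) => s /ltW.
have Xlim : vlim F X \1%VF.
  apply: (@vlim_squeeze _ _ F FF _ _ _ (fun s => vnorm (S s - \1%VF))).
    exact/vlim_normP.
  by apply: (@filterS _ F FF _ _ _ Sc) => s /XP[].
exists (fun s => h1 s \o X s)%VF.
  by rewrite -[\1%VF]comp_lfun1l; exact: vlim_comp.
have SE s x y : lker (h1 s) == 0%VS -> G s (S s x) y = g s x y.
  by move=> /Gpos/pos_nondeg Gnd; rewrite form_opE.
have GE s x y : G s x y = g0 (h1 s x) (h1 s y) by exact: pullbackE.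
have J0J x : J0 (J0 x) = - x by exact: ah_JJ.
have J0iso x y : g0 (J0 x) (J0 y) = g0 x y by exact: ah_Jiso.
have J0E x y : g0 (J0 x) y = w0 x y by exact: ah_JE.
have JJ s : almost_hermitian (w s) (g s) -> [/\ forall x, J s (J s x) = - x,
    forall x y, g s (J s x) (J s y) = g s x y & forall x y, g s (J s x) y = w s x y].
  by move=> Hs; split; [exact: ah_JJ|exact: ah_Jiso|exact: ah_JE].
clear Slim Glim h1lim; clearbody S G h1 J J0.
near=> s.
have Hs : almost_hermitian (w s) (g s) by near: s.
have k1 : lker (h1 s) == 0%VS by near: s.
have [XX _ XJ XB] : [/\ (X s \o X s)%VF = S s, vnorm (X s - \1%VF) <= vnorm (S s - \1%VF),
    forall J, (S s \o J)%VF = (J \o S s)%VF -> (X s \o J)%VF = (J \o X s)%VF &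
    forall B : bilform R V, (forall x y, B (S s x) y = B x (S s y)) ->
      forall x y, B (X s x) y = B x (X s y)].
  by apply: XP; near: s.
have Gnd := pos_nondeg (Gpos s k1).
have [JsJ Jiso JE] := JJ s Hs.
have {}SE x y : G s (S s x) y = g s x y by exact: SE.
have Gsym x y : G s x y = G s y x by rewrite !GE (ah_sym H0).
(* Both J0 (1 - J0 J) and (1 - J0 J) J equal J0 + J. *)
have h1J x : h1 s (J s x) = J0 (h1 s x).
  rewrite !h1E [RHS]linearZ /= [J0 (_ - _)]linearB /= J0J JsJ.
  by rewrite linearN /= !opprK addrC.
have GJ x y : G s (J s x) (J s y) = G s x y by rewrite !GE !h1J J0iso.
(* Both g and G are J-invariant, so the operator relating them commutes with J, and hence so does
   its square root. *)
have SJ : (S s \o J s)%VF = (J s \o S s)%VF.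
  apply/lfunP => x; rewrite !comp_lfunE; apply: (nondeg_eq Gnd) => y.
  by rewrite SE -[y]opprK -JsJ GJ SE Jiso.
have /lfunP XJ' := XJ _ SJ.
have {}XB x y : G s (X s x) y = G s x (X s y).
  by apply: XB => a b; rewrite SE Gsym SE (ah_sym Hs).
(* X is G-symmetric with square S, so G(X x, X y) = G(S x, y) = g(x, y). *)
have gE x y : g s x y = g0 ((h1 s \o X s)%VF x) ((h1 s \o X s)%VF y).
  rewrite !comp_lfunE -GE -XB -SE.
  by have /lfunP/(_ x) := XX; rewrite comp_lfunE => ->.
split=> //.
- rewrite -subv0; apply/subvP => x; rewrite memv_ker memv0 => /eqP hx.
  apply: contraT => x0; have := ah_pos Hs x0.
  by rewrite gE hx linear0 ltxx.
- move=> x y; rewrite -JE gE -J0E; congr (g0 _ _).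
  rewrite !comp_lfunE -h1J; congr (h1 s _).
  by have := XJ' x; rewrite !comp_lfunE.
Unshelve. all: by end_near. Qed.

End Frames.

(** * Continuity of the curvature operators *)

Section Rules.
Variables (R : realType).
Implicit Types (V W : vectType R).

(* The part of the standing assumptions that is used, in a form stable under
   the time reversal (p, q) |-> (-p, -q). *)
Record lip_rule (n : nat) (r : pq_rule R) : Prop := LipRule {
  lip_ty : pq_typed n r;
  lip_inv : pq_invariant n r;
  lip_comp : pq_compatible n r;
  lip_reg : forall V (w g : bilform R V) (mu : bimap V V),
    \dim {:V} = (2 * n)%N -> almost_hermitian w g -> lie_bracket mu ->
    exists FP FQ : subvs_of (alt2 V V) -> 'End(V),
      [/\ vlip FP (vsproj (alt2 V V) mu), vlip FQ (vsproj (alt2 V V) mu) &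
      forall m : bimap V V, lie_bracket m ->
        FP (vsproj (alt2 V V) m) = Pop r m w g /\
        FQ (vsproj (alt2 V V) m) = Qop r m w g] }.

Lemma standing_lip n r : pq_standing n r -> lip_rule n r.
Proof.
case=> rt ri rc rr _; split=> // V w g mu dV H hmu.
have [U [FP [FQ [oU lU sP sQ FPQ]]]] := rr V w g dV H.
have K (m : bimap V V) : lie_bracket m -> vsval (vsproj (alt2 V V) m) = m.
  by case=> ma _; rewrite vsprojK.
have Umu : U (vsproj (alt2 V V) mu) by apply: lU; rewrite K.
exists FP, FQ; split; [exact: smooth_vlip sP|exact: smooth_vlip sQ|].
by move=> m lm; have := FPQ (vsproj (alt2 V V) m); rewrite K//; exact.
Qed.

Lemma lftrace_coord V (A : 'End(V)) : lftrace A = \sum_i vcoord i (A (vb i)).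
Proof.
rewrite /lftrace /mxtrace; apply: eq_bigr => i _.
rewrite /passmx.mxof /lin1_mx mxE /= /passmx.rVof mxE vcoordE.
by rewrite passmx.vecof_delta.
Qed.

Lemma lftrace_linear V : linear (@lftrace R V : 'End(V) -> R^o).
Proof.
move=> a A B; rewrite !lftrace_coord scaler_sumr -big_split /=.
by apply: eq_bigr => i _; rewrite add_lfunE scale_lfunE linearP.
Qed.

Section Continuity.
Variables (n : nat) (r : pq_rule R).
Hypothesis hr : lip_rule n r.
Variables (V : vectType R) (mu : bimap V V).
Hypotheses (dV : \dim {:V} = (2 * n)%N) (hmu : lie_bracket mu).

(** Invariance along [h], seen as a Lie isomorphism from [mu] to the transported bracket: a change
    of the pair is traded for a change of the bracket, the only variable in which regularity is
    assumed. *)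
Lemma rule_transport (w g w0 g0 : bilform R V) (h k : 'End(V)) :
  almost_hermitian w g -> almost_hermitian w0 g0 ->
  (forall x, k (h x) = x) -> (forall x, h (k x) = x) ->
  (forall x y, w x y = w0 (h x) (h y)) -> (forall x y, g x y = g0 (h x) (h y)) ->
  forall x, h (Pop r mu w g x) = Pop r (push h k mu) w0 g0 (h x) /\
            h (Qop r mu w g x) = Qop r (push h k mu) w0 g0 (h x).
Proof.
move=> H H0 kh hk wE gE x.
have hlie : lie_bracket (push h k mu) by exact: push_lie.
have h0 : lker h == 0%VS by apply/lker0P; exact: can_inj kh.
have [|->->] := lip_inv hr dV dV hmu hlie H H0 (lker0_bij h0) _ wE gE.
  by move=> a b; rewrite pushE !kh.
by rewrite !comp_lfunE lker0_lfunK.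
Qed.

Lemma rule_vlim (T : Type) (F : set_system T) {FF : Filter F}
    (w g : T -> bilform R V) (w0 g0 : bilform R V) : almost_hermitian w0 g0 ->
  (\forall s \near F, almost_hermitian (w s) (g s)) ->
  vlim F w w0 -> vlim F g g0 ->
  vlim F (fun s => Pop r mu (w s) (g s)) (Pop r mu w0 g0) /\
  vlim F (fun s => Qop r mu (w s) (g s)) (Qop r mu w0 g0).
Proof.
move=> H0 H ww gg.
have [h hlim hP] := unitary_frame H0 H ww gg.
pose k s : 'End(V) := (h s)^-1%VF.
have ker s : lker (h s) == 0%VS -> (forall x, k s (h s x) = x) /\ (forall x, h s (k s x) = x).
  by move=> h0; split=> x; [exact: lker0_lfunK|exact: lker0_lfunVK].
(* Each k x solves h X = x with h tending to 1. *)
have klim : vlim F k \1%VF.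
  apply: vlim_hom => x; apply: (@near_one_solve _ _ F FF _ h _ (fun=> x)) => //.
    by apply: (@filterS _ F FF _ _ _ hP) => s [/ker[_ ->]].
  by rewrite id_lfunE; exact: vlim_cst.
pose m s := push (h s) (k s) mu.
have mlim : vlim F m mu.
  rewrite [mu](_ : _ = push \1%VF \1%VF mu); first exact: vlim_push.
  by apply/lfunP => x; apply/lfunP => y; rewrite pushE !id_lfunE.
have [FP [FQ [FPl FQl FPQ]]] := lip_reg hr dV H0 hmu.
have mvlim : vlim F (fun s => vsproj (alt2 V V) (m s)) (vsproj (alt2 V V) mu).
  have /(_ _ _ mlim) := @vlim_lin _ _ F _ _ (linfun (vsproj (alt2 V V))).
  rewrite lfunE (_ : linfun _ \o m = fun s => vsproj (alt2 V V) (m s))//.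
  by apply/funext => s; rewrite /= lfunE.
have [<- <-] := FPQ mu hmu.
(* P and Q are treated alike: O x solves h X = FO(m) (h x), whose right-hand side converges because
   m tends to [mu]. *)
suff main (O : T -> 'End(V)) (FO : subvs_of (alt2 V V) -> 'End(V)) :
    vlip FO (vsproj (alt2 V V) mu) ->
    (\forall s \near F, forall x, h s (O s x) = FO (vsproj (alt2 V V) (m s)) (h s x)) ->
    vlim F O (FO (vsproj (alt2 V V) mu)).
  have trans : \forall s \near F, forall x,
      h s (Pop r mu (w s) (g s) x) = FP (vsproj (alt2 V V) (m s)) (h s x) /\
      h s (Qop r mu (w s) (g s) x) = FQ (vsproj (alt2 V V) (m s)) (h s x).
    near=> s => x.
    have [/ker[kh hk] wE gE] : [/\ lker (h s) == 0%VS,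
        forall x y, w s x y = w0 (h s x) (h s y) &
        forall x y, g s x y = g0 (h s x) (h s y)] by near: s.
    have [|-> ->] := FPQ (m s); first exact: push_lie.
    by apply: rule_transport => //; near: s.
  by split; apply: main => //; apply: filterS trans => s sP x; have [] := sP x.
move=> FOl OE; apply: vlim_hom => x.
apply: (@near_one_solve _ _ F FF _ h _ (fun s => FO (vsproj (alt2 V V) (m s)) (h s x))) => //.
  by apply: filterS OE => s.
apply: vlim_eval; last by rewrite -[x in vlim _ _ x]id_lfunE; exact: vlim_app.
exact: (vlip_vlim FOl mvlim).
Unshelve. all: by end_near. Qed.

Lemma op_norm_cvg (T : Type) (F : set_system T) {FF : Filter F}
    (g : T -> bilform R V) (A : T -> 'End(V)) (g0 : bilform R V) (A0 : 'End(V)) :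
  Defs.nondegenerate g0 -> (\forall s \near F, Defs.nondegenerate (g s)) ->
  vlim F g g0 -> vlim F A A0 ->
  (fun s => op_norm (g s) (A s)) @ F --> op_norm g0 A0.
Proof.
move=> g0n gn gg AA.
have adj : vlim F (fun s => adjoint (g s) (A s)) (adjoint g0 A0).
  apply: form_op_vlim => //; apply: vlim_hom => y.
  have lin (B : bilform R V) C : linear (fun y => (B y \o C)%VF : 'Hom(V, R^o)).
    move=> a u v; apply/lfunP => z.
    by rewrite !(comp_lfunE, add_lfunE, scale_lfunE, linearP).
  rewrite (linfunE (lin _ _)); under eq_fun do rewrite (linfunE (lin _ _)).
  by apply: vlim_comp => //; exact: vlim_app.
have tr : vlim F (fun s => lftrace (A s \o adjoint (g s) (A s))%VF : R^o)
    (lftrace (A0 \o adjoint g0 A0)%VF : R^o).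
  have cc : vlim F (fun s => A s \o adjoint (g s) (A s))%VF (A0 \o adjoint g0 A0)%VF.
    exact: vlim_comp.
  have := @vlim_lin _ _ F _ _ (linfun (@lftrace R V : 'End(V) -> R^o)) _ _ cc.
  rewrite (linfunE (@lftrace_linear V)) (_ : linfun _ \o _ =
    fun s => lftrace (A s \o adjoint (g s) (A s))%VF : R^o)//.
  by apply/funext => s; rewrite /= (linfunE (@lftrace_linear V)).
exact: (cvg_comp _ _ ((vlim_scalar _ _).1 tr) (@sqrt_continuous R _)).
Qed.

Lemma PQac_norm_cvg (T : Type) (F : set_system T) {FF : Filter F}
    (w g : T -> bilform R V) (w0 g0 : bilform R V) : almost_hermitian w0 g0 ->
  (\forall s \near F, almost_hermitian (w s) (g s)) ->
  vlim F w w0 -> vlim F g g0 ->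
  (fun s => PQac_norm r mu (w s) (g s)) @ F --> PQac_norm r mu w0 g0.
Proof.
move=> H0 H ww gg; have [Pl Ql] := rule_vlim H0 H ww gg.
have Jl := vlim_Jop H0 H ww gg.
apply: op_norm_cvg => //; first exact: ah_gnd H0.
  by apply: filterS H => s; exact: ah_gnd.
apply: vlimD => //; apply: vlimZ; apply: vlimD => //.
apply: vlim_comp; [apply: vlim_comp; [exact: Jl|exact: Ql]|exact: Jl].
Qed.

End Continuity.

(** * The Hilbert-Schmidt norm dominates the operator norm *)

Section HilbertSchmidt.
Variables (V : vectType R) (g : bilform R V).
Hypotheses (gs : Defs.symmetric_form g) (gp : forall x, x != 0 -> (0 : R) < g x x).

Lemma cauchy_schwarz x y : g x y ^+ 2 <= (g x x : R) * g y y.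
Proof.
have [->|y0] := eqVneq y 0; first by rewrite !linear0 expr0n mulr0.
have gy := gp y0.
have := inner_ge0 (g y y *: x - g x y *: y) gp.
rewrite !(bilDl, bilDr, bilNl, bilNr, bilZl, bilZr) (gs y x).
move: (g x x : R) (g y y : R) (g x y : R) gy => a b c b0 H.
suff : 0 <= b * (a * b - c ^+ 2) by rewrite pmulr_rge0// subr_ge0.
by rewrite (le_trans H)// le_eqVlt; apply/orP; left; apply/eqP; ring.
Qed.

(** Gram-Schmidt: fewer than dim V vectors do not span, so some v lies outside their span and its
    projection residue is nonzero. *)
Lemma orthonormal_family k : (k <= \dim {:V})%N -> exists e : k.-tuple V,
  forall i j, g (tnth e i) (tnth e j) = (i == j)%:R :> R.
Proof.
elim: k => [|k IH] kd; first by exists [tuple] => -[].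
have [e eO] := IH (ltnW kd).
have /subvPn[v _ vne] : ~~ ({:V} <= <<e>>)%VS.
  apply/negP => /dimvS; rewrite leqNgt => /negP; apply.
  by rewrite (leq_ltn_trans (dim_span _))// size_tuple.
pose u := v - \sum_i g v (tnth e i) *: tnth e i.
have u0 : u != 0.
  apply: contra vne; rewrite subr_eq0 => /eqP->.
  by apply: memv_suml => i _; apply: memvZ; apply: memv_span; exact: mem_tnth.
have ue i : g u (tnth e i) = 0.
  rewrite bilDl bilNl linear_sum sum_lfunE (bigD1 i)//= bilZl eO eqxx mulr1.
  rewrite big1 ?addr0 ?subrr// => j ji.
  by rewrite bilZl eO (negPf ji) mulr0.
have gu := gp u0.
pose c := (Num.sqrt (g u u : R))^-1.
have c2 : c * c * g u u = 1 :> R.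
  rewrite -invfM -expr2 sqr_sqrtr ?mulVf//; first by rewrite gt_eqF.
  exact: ltW.
exists [tuple of c *: u :: e] => i j.
case: (unliftP ord0 i) => [i'|] ->; case: (unliftP ord0 j) => [j'|] ->;
  rewrite ?tnth0 ?tnthS ?(inj_eq lift_inj) ?eqxx.
- by rewrite eO.
- by rewrite gs bilZl ue mulr0.
- by rewrite bilZl ue mulr0.
- by rewrite bilZl bilZr mulrA c2.
Qed.

Lemma orthonormal_basis : exists e : (\dim {:V}).-tuple V,
  (forall i j, g (tnth e i) (tnth e j) = (i == j)%:R :> R) /\
  forall x, x = \sum_i g x (tnth e i) *: tnth e i.
Proof.
have [e eO] := orthonormal_family (leqnn _); exists e; split=> // x.
have fe : free e.
  apply/freeP => k k0 i.
  have : g (\sum_i k i *: e`_i) (tnth e i) = 0 by rewrite k0 linear0 zero_lfunE.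
  rewrite linear_sum sum_lfunE (bigD1 i)//= -tnth_nth bilZl eO eqxx mulr1.
  rewrite big1 ?addr0// => j ji.
  by rewrite -tnth_nth bilZl eO (negPf ji) mulr0.
have be : basis_of {:V} e by rewrite basisEfree fe subvf size_tuple leqnn.
rewrite {1}(coord_basis be (memvf x)); apply: eq_bigr => i _.
rewrite -tnth_nth; congr (_ *: _).
rewrite {2}(coord_basis be (memvf x)) linear_sum sum_lfunE (bigD1 i)//=.
rewrite -tnth_nth bilZl eO eqxx mulr1 big1 ?addr0// => j ji.
by rewrite -tnth_nth bilZl eO (negPf ji) mulr0.
Qed.

(** In an orthonormal basis, tr(A A^t) is the sum of the squared lengths of the vectors A^t e_j, and
    the coordinate g(A x, e_j) = g(x, A^t e_j) is bounded by Cauchy-Schwarz. *)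
Lemma op_norm_bound (A : 'End(V)) x :
  g (A x) (A x) <= op_norm g A ^+ 2 * (g x x : R).
Proof.
have gnd := pos_nondeg gp.
have [e [eO eE]] := orthonormal_basis.
have parseval u v : g u v = \sum_i (g u (tnth e i) : R) * g v (tnth e i) :> R.
  rewrite {1}(eE v) linear_sum /=; apply: eq_bigr => i _.
  exact: etrans (bilZr _ _ _ _) (mulrC _ _).
pose As := adjoint g A.
have AsE u v : g (As u) v = g u (A v) by exact: adjointE.
(* Basis independence of the trace: expand the images of [vb i] in [e] and exchange the sums. *)
have trE (B : 'End(V)) : lftrace B = \sum_j (g (B (tnth e j)) (tnth e j) : R).
  rewrite lftrace_coord.
  transitivity (\sum_i \sum_j (g (B (vb i)) (tnth e j) * vcoord i (tnth e j) : R)).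
    apply: eq_bigr => i _; rewrite {1}(eE (B (vb i))) linear_sum.
    by apply: eq_bigr => j _; exact: dualZ.
  rewrite exchange_big; apply: eq_bigr => j _ /=.
  transitivity (g (B (\sum_i vcoord i (tnth e j) *: vb i)) (tnth e j) : R).
    rewrite !linear_sum sum_lfunE /=; apply: eq_bigr => i _.
    by rewrite [B (_ *: _)]linearZ /= bilZl mulrC.
  by rewrite -vcoord_sum.
have tr : lftrace (A \o As)%VF = \sum_j (g (As (tnth e j)) (As (tnth e j)) : R).
  by rewrite trE; apply: eq_bigr => j _; rewrite comp_lfunE gs AsE.
have tr0 : 0 <= lftrace (A \o As)%VF.
  by rewrite tr; apply: sumr_ge0 => j _; exact: inner_ge0.
rewrite /op_norm sqr_sqrtr// tr mulr_suml parseval; apply: ler_sum => j _.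
by rewrite -expr2 gs -AsE cauchy_schwarz.
Qed.

End HilbertSchmidt.

End Rules.

(** * Local existence of the flow *)

Section LocalExistence.
Variables (R : realType) (n : nat) (r : pq_rule R).
Hypothesis hr : lip_rule n r.
Variables (V : vectType R) (mu : bimap V V).
Hypotheses (dV : \dim {:V} = (2 * n)%N) (hmu : lie_bracket mu).
Implicit Types (w g : bilform R V) (m : bimap V V).

Section Velocity.
Variables (m : bimap V V) (w g : bilform R V).
Hypotheses (hm : lie_bracket m) (H : almost_hermitian w g).
Let P := Pop r m w g.
Let Q := Qop r m w g.
Let J := Jop w g.
Let A := P + acpart J Q.

Lemma PopE x y : w (P x) y = rule_p r m w g x y.
Proof. by rewrite /P /Pop form_opE//; exact: ah_nondeg H. Qed.

Lemma QopE x y : g (Q x) y = rule_q r m w g x y.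
Proof. by rewrite /Q /Qop form_opE//; exact: ah_gnd H. Qed.

Lemma rule_p_anti x y : rule_p r m w g x y = - rule_p r m w g y x.
Proof. by rewrite (alt2_anti _ _ (lip_ty hr dV hm H).1). Qed.

(** P contributes p twice because p is alternating. The form w(Q^ac x, y) = g(J Q^ac x, y) is
    symmetric in x and y, so Q^ac contributes nothing. *)
Lemma velocity_w x y : w (A x) y + w x (A y) = 2 * rule_p r m w g x y :> R.
Proof.
have acE z : A z = P z + 2^-1 *: (Q z + J (Q (J z))).
  by rewrite add_lfunE scale_lfunE add_lfunE !comp_lfunE.
have Qs a b : g (Q a) b = g a (Q b).
  by rewrite QopE (lip_ty hr dV hm H).2 -QopE (ah_sym H).
have Pw a b : w a (P b) = rule_p r m w g a b.
  by rewrite (alt2_anti _ _ (ah_alt H)) PopE rule_p_anti opprK.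
have wQ : w (Q x + J (Q (J x))) y + w x (Q y + J (Q (J y))) = 0 :> R.
  rewrite -!(ah_JE H) -/J linearD /= !(bilDl, bilDr) (ah_JJ H) bilNl.
  rewrite (ah_Jiso H) (ah_Jskew H (Q x)) -/J (Qs (J x)) -(Qs x).
  by move: (g (Q x) (J y) : R) (g (J x) (Q y) : R) => ? ?; lra.
rewrite !acE !(bilDl, bilDr) PopE Pw !(bilZl, bilZr).
move: wQ; rewrite !(bilDl, bilDr).
move: (w (Q x) y : R) (w (J (Q (J x))) y : R) (w x (Q y) : R) (w x (J (Q (J y))) : R) => ? ? ? ?.
by move: (rule_p r m w g x y : R) => ?; lra.
Qed.

(* By P^c = Q^c, A = Q + P^ac, and P^ac is skew for g. *)
Lemma velocity_g x y : g (A x) y + g x (A y) = 2 * rule_q r m w g x y :> R.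
Proof.
have JPE a b : g (J (P a)) b = rule_p r m w g a b by rewrite (ah_JE H) PopE.
have Pg a b : g (P a) b = rule_p r m w g a (J b) by rewrite -(ah_Jiso H) JPE.
have comp z : P z = Q z - J (Q (J z)) + J (P (J z)).
  have /lfunP/(_ z) := lip_comp hr dV hm H.
  rewrite !scale_lfunE !add_lfunE !opp_lfunE !comp_lfunE => /scalerI.
  by rewrite invr_eq0 pnatr_eq0 => /(_ isT) <-; rewrite subrK.
have acE z : A z = Q z + 2^-1 *: (P z + J (P (J z))).
  have -> : A z = P z + 2^-1 *: (Q z + J (Q (J z))).
    by rewrite add_lfunE scale_lfunE add_lfunE !comp_lfunE.
  apply: vcoord_eq => i; have := congr1 (fun v => vcoord i v : R) (comp z).
  have D u v : vcoord i (u + v) = vcoord i u + vcoord i v :> R by rewrite linearD.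
  have N u : vcoord i (- u) = - vcoord i u :> R by rewrite linearN.
  rewrite !(D, N, dualZ).
  move: (vcoord i (P z) : R) (vcoord i (Q z) : R) (vcoord i (J (Q (J z))) : R) => a b c.
  by move: (vcoord i (J (P (J z))) : R) => e; lra.
(* Here g(P x, y) = p(x, J y) and g(J P J x, y) = p(J x, y); adding the terms with x and y
   exchanged, everything cancels as p is alternating. *)
have sk : g (P x + J (P (J x))) y + g x (P y + J (P (J y))) = 0 :> R.
  rewrite !(bilDl, bilDr) !(ah_sym H x) !JPE !Pg.
  rewrite (rule_p_anti (J x)) (rule_p_anti (J y)).
  by move: (rule_p r m w g x (J y) : R) (rule_p r m w g y (J x) : R) => ? ?; lra.
have Qs : g x (Q y) = rule_q r m w g x y.
  by rewrite (ah_sym H) QopE (lip_ty hr dV hm H).2.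
rewrite !acE [X in X + _]bilDl [X in _ + X]bilDr bilZl bilZr QopE Qs.
by move: sk; move: (g _ y : R) (g x _ : R) (rule_q r m w g x y : R) => ? ? ?; lra.
Qed.

End Velocity.

(** The pair is written as a sum of linear injections because [vnorm] on the product is read in a
    basis unrelated to those of the factors. *)
Lemma vlip_pair (U W1 W2 : vectType R) (f1 : U -> W1) (f2 : U -> W2) x0 :
  vlip f1 x0 -> vlip f2 x0 -> vlip (fun z => (f1 z, f2 z)) x0.
Proof.
move=> l1 l2.
have i1l : linear (fun a : W1 => (a, 0 : W2)).
  by move=> a u v; apply/eqP; rewrite xpair_eqE /= scaler0 addr0 !eqxx.
have i2l : linear (fun a : W2 => (0 : W1, a)).
  by move=> a u v; apply/eqP; rewrite xpair_eqE /= scaler0 addr0 !eqxx.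
have -> : (fun z => (f1 z, f2 z)) = fun z =>
    linfun (fun a : W1 => (a, 0 : W2)) (f1 z) + linfun (fun a : W2 => (0 : W1, a)) (f2 z).
  apply/funext => z; rewrite (linfunE i1l) (linfunE i2l).
  by apply/eqP; rewrite xpair_eqE /= addr0 add0r !eqxx.
by apply: vlipD; exact: vlip_linl.
Qed.

(* With k the inverse of h, the pulled-back pair (h^* w0, h^* g0) solves the flow
   as soon as h' = - A h, where A is the operator P + Q^ac of (w0, g0) for the
   transported bracket h mu(k ., k .); the system for (h, k) is polynomial in
   (h, k) apart from A. *)
Lemma flow_local (w0 g0 : bilform R V) (T : R) : almost_hermitian w0 g0 ->
  exists2 d : R, 0 < d & exists w g : R -> bilform R V,
    [/\ w T = w0, g T = g0 & flow_solution r mu w g (T - d)%:E (T + d)%:E].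
Proof.
move=> H0.
have [FP [FQ [FPl FQl FPQ]]] := lip_reg hr dV H0 hmu.
pose J0 := Jop w0 g0.
pose E : vectType R := ('End(V) * 'End(V))%type.
have fl : linear (fun z : E => z.1) by [].
have sl : linear (fun z : E => z.2) by [].
pose m (z : E) := vsproj (alt2 V V) (push z.1 z.2 mu).
pose A (z : E) : 'End(V) := FP (m z) + acpart J0 (FQ (m z)).
pose field (z : E) : E := (- (A z \o z.1)%VF, (z.2 \o A z)%VF).
pose z0 : E := (\1%VF, \1%VF).
have l1 : vlip (fun z : E => z.1) z0.
  have := vlip_lin (linfun (fun z : E => z.1)) z0.
  by rewrite (_ : fun_of_lfun _ = fun z : E => z.1)//; apply/funext => z; rewrite (linfunE fl).
have l2 : vlip (fun z : E => z.2) z0.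
  have := vlip_lin (linfun (fun z : E => z.2)) z0.
  by rewrite (_ : fun_of_lfun _ = fun z : E => z.2)//; apply/funext => z; rewrite (linfunE sl).
have push1 : push \1%VF \1%VF mu = mu.
  by apply/lfunP => x; apply/lfunP => y; rewrite pushE !id_lfunE.
have ml : vlip m z0.
  have -> : m = fun z => linfun (vsproj (alt2 V V)) (push z.1 z.2 mu).
    by apply/funext => z; rewrite lfunE.
  apply: vlip_linl; apply: vlip_hom => x; apply: vlip_hom => y.
  have -> : (fun z : E => push z.1 z.2 mu x y) = fun z : E => z.1 (mu (z.2 x) (z.2 y)).
    by apply/funext => z; rewrite pushE.
  apply: vlip_eval => //; apply: vlip_eval; last exact: vlip_app.
  by apply: vlip_linl; exact: vlip_app.
(* At the initial state the transported bracket is [mu] itself, so Lipschitz bounds near [mu] are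
   enough for Picard. *)
have mz0 : m z0 = vsproj (alt2 V V) mu by rewrite /m push1.
have Al : vlip A z0.
  apply: vlipD; first by apply: (vlip_comp (g := FP)) => //; rewrite mz0.
  have Ql : vlip (FQ \o m) z0 by apply: vlip_comp => //; rewrite mz0.
  have -> : (fun z => acpart J0 (FQ (m z))) =
      fun z => (2^-1 *: \1%VF : 'End('End(V))) (FQ (m z) + (J0 \o FQ (m z) \o J0)%VF).
    by apply/funext => z; rewrite scale_lfunE id_lfunE.
  apply: vlip_linl; apply: vlipD => //.
  apply: vlip_lfcomp; last exact: vlip_cst.
  by apply: vlip_lfcomp => //; exact: vlip_cst.
have fieldl : vlip field z0.
  apply: vlip_pair.
    have -> : (fun z : E => - (A z \o z.1)%VF) =
        fun z => (- \1%VF : 'End('End(V))) (A z \o z.1)%VF.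
      by apply/funext => z; rewrite opp_lfunE id_lfunE.
    by apply: vlip_linl; exact: vlip_lfcomp.
  exact: vlip_lfcomp.
have [d d0 [c [cT cP]]] := picard T fieldl.
pose h t := (c t).1; pose k t := (c t).2.
have hder t : `|t - T| < d -> vder h t (- (A (c t) \o h t)%VF).
  move=> /cP/(vder_lin (linfun (fun z : E => z.1))).
  rewrite (linfunE fl) (_ : _ \o c = h)//.
  by apply/funext => s; rewrite /= (linfunE fl).
have kder t : `|t - T| < d -> vder k t (k t \o A (c t))%VF.
  move=> /cP/(vder_lin (linfun (fun z : E => z.2))).
  rewrite (linfunE sl) (_ : _ \o c = k)//.
  by apply/funext => s; rewrite /= (linfunE sl).
have IE t : (T - d < t < T + d) = (`|t - T| < d).
  by rewrite ltr_norml; apply/idP/idP => /andP[? ?]; apply/andP; split; lra.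
(* The derivative of k h is k (- A h) + (k A) h = 0, so k remains a left inverse of h throughout. *)
have kh t : `|t - T| < d -> (k t \o h t = \1)%VF.
  move=> td; have -> : \1%VF = (k T \o h T)%VF by rewrite /k /h cT comp_lfun1l.
  apply: (vder0_cst (c := fun t => (k t \o h t)%VF) (a := T - d) (b := T + d)).
  - move=> s; rewrite IE => sd.
    have -> : 0 = ((k s \o - (A (c s) \o h s)) + ((k s \o A (c s)) \o h s))%VF.
      by rewrite comp_lfunNr comp_lfunA addNr.
    by apply: vder_comp; [exact: kder|exact: hder].
  - by rewrite IE.
  - by rewrite IE subrr normr0.
have khE t x : `|t - T| < d -> k t (h t x) = x.
  by move=> /kh/lfunP/(_ x); rewrite comp_lfunE id_lfunE.
have h0 t : `|t - T| < d -> lker (h t) == 0%VS.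
  by move=> td; apply/lker0P; apply: (can_inj (g := k t)) => x; exact: khE.
have hkE t x : `|t - T| < d -> h t (k t x) = x.
  by move=> td; rewrite -{1}(lker0_lfunVK (h0 t td) x) khE// lker0_lfunVK// h0.
exists d => //; exists (fun t => pullback (h t) w0), (fun t => pullback (h t) g0).
have pull1 (B : bilform R V) : pullback (h T) B = B.
  by apply/lfunP => x; apply/lfunP => y; rewrite pullbackE /h cT !id_lfunE.
split=> // t; rewrite /eitv /= !lte_fin => -[tl tr].
have td : `|t - T| < d by rewrite -IE tl.
have Ht := pullback_ah (h0 t td) H0.
set M := push (h t) (k t) mu.
have lM : lie_bracket M by apply: push_lie => // x; exact: khE.
have AE : A (c t) = Pop r M w0 g0 + acpart J0 (Qop r M w0 g0).
  by have [PE QE] := FPQ M lM; rewrite /A -PE -QE.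
have trans x : h t (Pop r mu (pullback (h t) w0) (pullback (h t) g0) x) =
      Pop r M w0 g0 (h t x) /\
    h t (Qop r mu (pullback (h t) w0) (pullback (h t) g0) x) = Qop r M w0 g0 (h t x).
  apply: (rule_transport hr dV hmu Ht H0).
  - by move=> y; exact: khE.
  - by move=> y; exact: hkE.
  - by move=> a b; rewrite pullbackE.
  - by move=> a b; rewrite pullbackE.
have pder (B : bilform R V) x y : is_derive t (1 : R) (fun s => pullback (h s) B x y : R)
    (- (B (A (c t) (h t x)) (h t y) + B (h t x) (A (c t) (h t y))) : R).
  apply/vder_scalar; under eq_fun do rewrite pullbackE.
  have hx z := vder_app z (hder t td).
  have := vder_eval (vder_lin B (hx x)) (hx y).
  rewrite !opp_lfunE !comp_lfunE bilNr linearN opp_lfunE addrC -opprD.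
  exact.
split=> // x y.
- have := pder w0 x y; rewrite AE velocity_w// -PopE// -(trans x).1 -pullbackE.
  by rewrite PopE// mulNr.
- have := pder g0 x y; rewrite AE velocity_g// -QopE// -(trans x).2 -pullbackE.
  by rewrite QopE// mulNr.
Qed.

End LocalExistence.

(** * Extension past a finite endpoint *)

Section LeftLimits.
Variable R : realType.

Lemma derive_ge0_homo (f df : R -> R) (a b : R) :
  (forall x, a < x < b -> is_derive x (1 : R) f (df x)) ->
  (forall x, a < x < b -> 0 <= df x) ->
  forall s t, a < s -> s <= t -> t < b -> f s <= f t.
Proof.
move=> fd df0 s t as_; rewrite le_eqVlt => /predU1P[->//|st tb].
have [|x /andP[sx xt] fE] := MVT_open st (df := df) (f := f).
  by move=> x /andP[sx xt]; apply: fd; rewrite (lt_le_trans as_ sx) (le_lt_trans xt tb).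
rewrite -subr_ge0 fE mulr_ge0 ?subr_ge0 ?(ltW st)//.
by apply: df0; rewrite (lt_trans as_ sx) (lt_trans xt tb).
Qed.

(** Both K Phi + f and K Phi - f are nondecreasing with limits at T, and f is half their
    difference. *)
Lemma dominated_left_cvg (f df Phi al : R -> R) (c T K M : R) : c < T -> 0 <= K ->
  (forall t, c < t < T -> [/\ is_derive t (1 : R) f (df t),
    is_derive t (1 : R) Phi (al t), `|df t| <= K * al t & `|Phi t| <= M]) ->
  exists l : R, f @ T^'- --> l.
Proof.
move=> cT K0 H.
have cvgu (sg : bool) (u := fun t => K * Phi t + (-1) ^+ sg * f t) : cvg (u @ T^'-).
  have uH (b : bool) (s t : R) : c < s -> s <= t -> t < T ->
      K * Phi s + (-1) ^+ b * f s <= K * Phi t + (-1) ^+ b * f t.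
    apply: (@derive_ge0_homo (fun t => K * Phi t + (-1) ^+ b * f t)
      (fun t => K * al t + (-1) ^+ b * df t)) => x cxT; have [fd Pd fb _] := H x cxT.
      have d1 := is_deriveM (is_derive_cst K x (1 : R)) Pd.
      have d2 := is_deriveM (is_derive_cst ((-1) ^+ b : R) x (1 : R)) fd.
      apply: (is_derive_eq (is_deriveD d1 d2)).
      by rewrite !scaler0 !addr0.
    by move: fb; rewrite ler_norml => /andP[? ?]; case: b; rewrite ?expr0 ?expr1; lra.
  apply: nondecreasing_at_left_is_cvgr.
    near=> x => s t; rewrite !in_itv/= => /andP[xs sT] /andP[xt tT] st.
    apply: uH => //; apply: lt_trans xs; near: x; exact: nbhs_left_gt.
  near=> x; exists (2 * K * M - (K * Phi x + (-1) ^+ (~~ sg) * f x)) => _ /= [t + <-].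
  rewrite in_itv/= => /andP[xt tT].
  have cx : c < x by near: x; exact: nbhs_left_gt.
  have := uH (~~ sg) x t cx (ltW xt) tT.
  have [|_ _ _] := H t; first by rewrite (lt_trans cx xt).
  rewrite ler_norml => /andP[_ PM] uxt.
  have KPM : K * Phi t <= K * M by rewrite ler_wpM2l.
  by rewrite /u; move: uxt; case: (sg); rewrite /= ?expr0 ?expr1; lra.
have /cvg_ex[l0 c0] := cvgu false; have /cvg_ex[l1 c1] := cvgu true.
exists (2^-1 * (l0 - l1)).
rewrite [f](_ : _ = fun t => 2^-1 * ((K * Phi t + (-1) ^+ false * f t) -
  (K * Phi t + (-1) ^+ true * f t))).
  by apply: cvgM; [exact: cvg_cst|apply: cvgB; [exact: c0|exact: c1]].
by apply/funext => t; rewrite expr0 expr1; lra.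
Unshelve. all: by end_near. Qed.

(* Gronwall: f exp (2 Phi) is nondecreasing and f exp (- 2 Phi) nonincreasing. *)
Lemma gronwall_bounds (f df Phi al : R -> R) (c T M : R) :
  (forall t, c < t < T -> [/\ is_derive t (1 : R) f (df t),
    is_derive t (1 : R) Phi (al t), `|df t| <= 2 * al t * f t & `|Phi t| <= M]) ->
  forall s t, c < s -> s <= t -> t < T -> 0 <= f s -> 0 <= f t ->
    f s * expR (- (4 * M)) <= f t /\ f t <= f s * expR (4 * M).
Proof.
move=> H s t cs st tT fs0 ft0.
have dexp (a x : R) : c < x < T ->
    is_derive x (1 : R) (fun y => f y * expR (a * Phi y))
     ((df x + a * al x * f x) * expR (a * Phi x)).
  move=> cxT; have [fd Pd _ _] := H x cxT.
  have d1 := is_deriveM (is_derive_cst a x (1 : R)) Pd.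
  have d2 := @is_derive1_comp _ expR _ x _ _ (is_derive_expR _) d1.
  apply: (is_derive_eq (is_deriveM fd d2)).
  rewrite /= scaler0 addr0 -[_ *: al x]/(a * al x).
  rewrite -[f x *: _]/(f x * (expR (a * Phi x) * (a * al x))).
  by rewrite -[_ *: df x]/(expR (a * Phi x) * df x); ring.
have ex0 (x : R) : 0 <= expR x by exact: expR_ge0.
(* The exponential costs a factor exp(2 M) at each of the times s and t, whence exp(4 M) in the
   conclusion. *)
have bnd x : c < x < T -> forall a, (a = 2 \/ a = -2) ->
    expR (- (2 * M)) <= expR (a * Phi x) <= expR (2 * M).
  move=> /H[_ _ _]; rewrite ler_norml => /andP[? ?] a [->|->];
  by rewrite !ler_expR; apply/andP; split; lra.
have sI : c < s < T by rewrite cs (le_lt_trans st).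
have tI : c < t < T by rewrite tT (lt_le_trans cs).
have E4 : expR (4 * M) = expR (2 * M) * expR (2 * M) by rewrite -expRD; congr expR; ring.
have E4N : expR (- (4 * M)) = expR (- (2 * M)) * expR (- (2 * M)).
  by rewrite -expRD; congr expR; ring.
have Einv : expR (2 * M) * expR (- (2 * M)) = 1 by rewrite -expRD subrr expR0.
have e1 := expR_gt0 (2 * M); have e2 := expR_gt0 (- (2 * M)).
split.
- have : f s * expR (2 * Phi s) <= f t * expR (2 * Phi t).
    apply: (@derive_ge0_homo (fun x => f x * expR (2 * Phi x)) (fun x => (df x + 2 * al x * f x) * expR (2 * Phi x)) c T) => // x cxT.
    have [_ _ fb _] := H x cxT; apply: mulr_ge0 => //.
    by move: fb; rewrite ler_norml => /andP[? ?]; lra.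
  have /andP[l1 _] := bnd s sI 2 (or_introl erefl).
  have /andP[_ l2] := bnd t tI 2 (or_introl erefl).
  have m1 := ler_wpM2l fs0 l1; have m2 := ler_wpM2l ft0 l2.
  move=> le; have {}le := le_trans m1 (le_trans le m2).
  have := ler_wpM2r (ltW e2) le.
  by rewrite -mulrA -E4N -[X in _ <= X]mulrA Einv mulr1.
- have : - (f s * expR (-2 * Phi s)) <= - (f t * expR (-2 * Phi t)).
    apply: (@derive_ge0_homo (fun x => - (f x * expR (-2 * Phi x)))
      (fun x => - ((df x + -2 * al x * f x) * expR (-2 * Phi x))) c T) => // x cxT.
      by apply: is_deriveN; exact: dexp.
    have [_ _ fb _] := H x cxT; rewrite -mulNr; apply: mulr_ge0 => //.
    by move: fb; rewrite ler_norml => /andP[? ?]; lra.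
  rewrite lerN2.
  have /andP[l1 _] := bnd t tI (-2) (or_intror erefl).
  have /andP[_ l2] := bnd s sI (-2) (or_intror erefl).
  have m1 := ler_wpM2l ft0 l1; have m2 := ler_wpM2l fs0 l2.
  move=> le; have {}le := le_trans m1 (le_trans le m2).
  have := ler_wpM2r (ltW e1) le.
  by rewrite -mulrA [expR (- _) * _]mulrC Einv mulr1 -mulrA -E4.
Qed.

(** A difference quotient at T is a value of d between T and T + h, so it tends to d T. This yields
    the flow equation at the gluing time, where the given solution has only a left limit. *)
Lemma is_derive_limit (f d : R -> R) (T : R) :
  f @ T --> f T -> d @ T --> d T ->
  (\forall s \near T, s != T -> is_derive s (1 : R) f (d s)) ->
  is_derive T (1 : R) f (d T).
Proof.
move=> fc dc /nbhs_ballP[e /= e0 fd].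
have fd' s : `|s - T| < e -> s != T -> is_derive s (1 : R) f (d s).
  by move=> sT; apply: fd; rewrite /ball /= distrC.
have fcont s : `|s - T| < e -> f @ s --> f s.
  move=> sT; have [->//|sn] := eqVneq s T.
  exact: is_derive_cvg (fd' s sT sn).
(* Only intervals with T as an endpoint are used: inside them f is differentiable, and at T
   continuity suffices. *)
have mvt a b : a < b -> `|a - T| < e -> `|b - T| < e -> (a = T \/ b = T) ->
    exists2 x, a < x < b & f b - f a = d x * (b - a).
  move=> ab aT bT abT.
  have in_e x : a <= x <= b -> `|x - T| < e.
    by move: aT bT; rewrite !ltr_norml => ? ? ?; lra.
  have [x||x] := @MVT R f d a b ab.
  - rewrite in_itv/= => /andP[ax xb]; apply: fd'.
      by apply: in_e; rewrite !ltW.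
    by case: abT => <-; [rewrite gt_eqF|rewrite lt_eqF].
  - apply: continuous_in_subspaceT => x; rewrite inE /= in_itv/= => axb.
    exact: fcont (in_e x axb).
  - by rewrite in_itv/=; exists x.
have lim : (fun h => h^-1 *: (f (h *: (1 : R^o) + T) - f T : R^o)) @ (0 : R)^' --> (d T : R).
  apply/cvgrPdist_le => eps eps0.
  have /cvgr_dist_lt/(_ eps eps0)/nbhs_ballP[r /= r0 dr] := dc.
  near=> h.
  have hn0 : h != 0 by near: h; exact: nbhs_dnbhs_neq.
  have he : `|h| < e by near: h; exact: dnbhs0_lt.
  have hr : `|h| < r by near: h; exact: dnbhs0_lt.
  rewrite -[h *: 1]/(h * 1) mulr1 -[_ *: _]/(h^-1 * (f (h + T) - f T)).
  suff [x xT ->] : exists2 x, `|x - T| < r & h^-1 * (f (h + T) - f T) = d x.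
    by apply: ltW; apply: dr; rewrite /ball /= distrC.
  have [h0|h0|/eqP] := ltgtP h 0; last by rewrite (negPf hn0).
  - have [||||x xI fE] := mvt (h + T) T; rewrite ?subrr ?normr0 ?addrK//; first by lra.
      by right.
    exists x.
      by move: xI hr; rewrite (ltr0_norm h0) ltr_norml => /andP[? ?] ?; apply/andP; split; lra.
    have -> : f (h + T) - f T = d x * h by rewrite -[LHS]opprB fE; ring.
    by rewrite mulrCA mulVf ?mulr1.
  - have [||||x xI fE] := mvt T (h + T); rewrite ?subrr ?normr0 ?addrK//; first by lra.
      by left.
    exists x.
      by move: xI hr; rewrite (gtr0_norm h0) ltr_norml => /andP[? ?] ?; apply/andP; split; lra.
    by rewrite fE addrK mulrCA mulVf ?mulr1.
split; first by apply/cvg_ex; eexists; exact: lim.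
by apply/cvg_lim; [exact: Rhausdorff|exact: lim].
Unshelve. all: by end_near. Qed.

Lemma vlim_hom_ex (S : Type) (F : set_system S) {FF : Filter F} (V W : vectType R)
    (c : S -> 'Hom(V, W)) :
  (forall x, exists l, vlim F (fun s => c s x) l) -> exists l, vlim F c l.
Proof.
move=> cl; have [rk rkE] := hom_rank1 V W; have [l lP] := choice cl.
exists (\sum_i rk i (l (vb i))); rewrite [c](_ : _ = fun s => \sum_i rk i (c s (vb i))).
  move=> f; rewrite linear_sum; under eq_fun do rewrite linear_sum.
  apply: cvg_sumR => i.
  have ci : vlim F (rk i \o (fun s => c s (vb i))) (rk i (l (vb i))) by exact: vlim_lin.
  exact: ci.
by apply/funext => s; exact: rkE.
Qed.

End LeftLimits.

Section Extension.
Variables (R : realType) (n : nat) (r : pq_rule R).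
Hypothesis hr : lip_rule n r.
Variables (V : vectType R) (mu : bimap V V).
Hypotheses (dV : \dim {:V} = (2 * n)%N) (hmu : lie_bracket mu).

Let vel (w g : bilform R V) : 'End(V) :=
  Pop r mu w g + acpart (Jop w g) (Qop r mu w g).

(** Cauchy-Schwarz applied to the two velocity identities, J being a g-isometry in the case of w.
    Off the diagonal the sum of squared lengths replaces their geometric mean; the diagonal bound on
    q closes up for Gronwall. *)
Lemma velocity_bound (w g : bilform R V) (al : R) : almost_hermitian w g -> 0 <= al ->
  (forall x, g (vel w g x) (vel w g x) <= al ^+ 2 * (g x x : R)) ->
  [/\ forall x y, `|rule_p r mu w g x y : R| <= al * (g x x + g y y : R),
      forall x y, `|rule_q r mu w g x y : R| <= al * (g x x + g y y : R) &
      forall x, `|rule_q r mu w g x x : R| <= al * (g x x : R)].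
Proof.
move=> H al0 bd.
have ge0 x : 0 <= (g x x : R) by apply: inner_ge0; exact: ah_pos H.
have sqle (a b : R) : 0 <= b -> a ^+ 2 <= b ^+ 2 -> `|a| <= b.
  by move=> b0; rewrite -real_normK ?num_real// ler_pXn2r// nnegrE.
have cs u v := cauchy_schwarz (ah_sym H) (ah_pos H) u v.
have gA x y : `|g (vel w g x) y : R| <= al * (g x x + g y y : R).
  apply: sqle; first by rewrite mulr_ge0// addr_ge0.
  rewrite (le_trans (cs _ _))// (le_trans (ler_wpM2r (ge0 y) (bd x)))//.
  rewrite exprMn -mulrA ler_wpM2l ?sqr_ge0//.
  by move: (g x x : R) (g y y : R) (ge0 x) (ge0 y) => a b a0 b0; nra.
have gJA x y : `|g (Jop w g (vel w g x)) y : R| <= al * (g x x + g y y : R).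
  apply: sqle; first by rewrite mulr_ge0// addr_ge0.
  rewrite (le_trans (cs _ _))// (ah_Jiso H) (le_trans (ler_wpM2r (ge0 y) (bd x)))//.
  rewrite exprMn -mulrA ler_wpM2l ?sqr_ge0//.
  by move: (g x x : R) (g y y : R) (ge0 x) (ge0 y) => a b a0 b0; nra.
split=> [x y|x y|x].
- have := velocity_w hr dV hmu H x y; rewrite -/(vel w g).
  rewrite (alt2_anti x (vel w g y) (ah_alt H)) -!(ah_JE H).
  move: (gJA x y) (gJA y x); rewrite [g y y + _]addrC !ler_norml.
  by move=> /andP[? ?] /andP[? ?] ?; apply/andP; split; lra.
- have := velocity_g hr dV hmu H x y; rewrite -/(vel w g) (ah_sym H x).
  move: (gA x y) (gA y x); rewrite [g y y + _]addrC !ler_norml.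
  by move=> /andP[? ?] /andP[? ?] ?; apply/andP; split; lra.
- have gAx : `|g (vel w g x) x : R| <= al * (g x x : R).
    apply: sqle; first by rewrite mulr_ge0.
    rewrite (le_trans (cs _ _))// (le_trans (ler_wpM2r (ge0 x) (bd x)))//.
    by rewrite exprMn -mulrA -expr2.
  have := velocity_g hr dV hmu H x x; rewrite -/(vel w g) (ah_sym H x).
  move: gAx; rewrite !ler_norml.
  by move=> /andP[? ?] ?; apply/andP; split; lra.
Qed.

Section Limit.
Variables (w g : R -> bilform R V) (c T M : R) (Phi al : R -> R).
Hypothesis cT : c < T.
Hypothesis flow : flow_solution r mu w g c%:E T%:E.
Hypothesis PhiP : forall t, c < t < T -> is_derive t (1 : R) Phi (al t) /\ `|Phi t| <= M.
Hypothesis al0 : forall t, c < t < T -> 0 <= al t.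
Hypothesis alP : forall t, c < t < T -> forall x,
  g t (vel (w t) (g t) x) (vel (w t) (g t) x) <= al t ^+ 2 * (g t x x : R).

Let flowP t : c < t < T -> [/\ almost_hermitian (w t) (g t),
  (forall x y, is_derive t (1 : R) (fun s => w s x y : R) (- 2 * rule_p r mu (w t) (g t) x y : R)) &
  (forall x y, is_derive t (1 : R) (fun s => g s x y : R) (- 2 * rule_q r mu (w t) (g t) x y : R))].
Proof. by move=> /andP[ct tT]; apply: flow; rewrite /eitv /= !lte_fin. Qed.

(** The danger is degeneration of the limit: the lower Gronwall bound keeps [gT] positive definite,
    while the algebraic conditions pass to the limit. *)
Lemma flow_left_limit : exists wT gT : bilform R V,
  [/\ vlim T^'- w wT, vlim T^'- g gT & almost_hermitian wT gT].
Proof.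
(* The reference metric is taken at an interior time, since the flow is assumed only on the open
   interval ]c, T[. *)
pose s0 := (c + T) / 2.
have [cs0 s0T] : c < s0 /\ s0 < T by split; [exact: (midf_lt cT).1|exact: (midf_lt cT).2].
have sub t : s0 < t < T -> c < t < T by move=> /andP[? ->]; rewrite (lt_trans cs0).
have ge0 t x : c < t < T -> 0 <= (g t x x : R).
  by move=> /flowP[H _ _]; apply: inner_ge0; exact: ah_pos H.
have vb t (ctT : c < t < T) := let: And3 H _ _ := flowP ctT in
  velocity_bound H (al0 ctT) (alP ctT).
have cs0T : c < s0 < T by rewrite cs0.
have gbd x t : s0 < t < T ->
    (g s0 x x : R) * expR (- (4 * M)) <= g t x x /\
    g t x x <= (g s0 x x : R) * expR (4 * M).
  move=> st; have /andP[s0t tT] := st.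
  apply: (@gronwall_bounds _ (fun t => g t x x : R)
    (fun t => - 2 * rule_q r mu (w t) (g t) x x : R) Phi al c T M) => //.
  - move=> u ucT; have [_ _ gd] := flowP ucT; have [Pd PM] := PhiP ucT; split=> //.
    have [_ _ /(_ x) qb] := vb u ucT.
    by rewrite normrM normrN [`|2|]ger0_norm// -mulrA ler_wpM2l.
  - exact: ltW.
  - exact: ge0.
  - by apply: ge0; exact: sub.
pose K x y : R := 2 * (expR (4 * M) * (g s0 x x + g s0 y y : R)).
have K0 x y : 0 <= K x y by rewrite !mulr_ge0 ?expR_ge0 ?addr_ge0 ?ge0.
have KP x y t : s0 < t < T -> 2 * (al t * (g t x x + g t y y : R)) <= K x y * al t.
  move=> st; have [_ gx] := gbd x t st; have [_ gy] := gbd y t st.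
  rewrite /K [X in _ <= X]mulrC [X in X <= _]mulrCA ler_wpM2l ?al0 ?sub//.
  by rewrite ler_wpM2l// mulrC mulrDl lerD.
have wlim x y : exists l : R, (fun t => w t x y : R) @ T^'- --> l.
  apply: (@dominated_left_cvg _ _ (fun t => - 2 * rule_p r mu (w t) (g t) x y : R)
    Phi al s0 T (K x y) M) => // t st.
  have ctT := sub t st; have [_ wd _] := flowP ctT; have [Pd PM] := PhiP ctT; split=> //.
  have [/(_ x y) pb _ _] := vb t ctT.
  apply: le_trans (KP x y t st).
  by rewrite normrM normrN [`|2|]ger0_norm// ler_wpM2l.
have glim x y : exists l : R, (fun t => g t x y : R) @ T^'- --> l.
  apply: (@dominated_left_cvg _ _ (fun t => - 2 * rule_q r mu (w t) (g t) x y : R)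
    Phi al s0 T (K x y) M) => // t st.
  have ctT := sub t st; have [_ _ gd] := flowP ctT; have [Pd PM] := PhiP ctT; split=> //.
  have [_ /(_ x y) qb _] := vb t ctT.
  apply: le_trans (KP x y t st).
  by rewrite normrM normrN [`|2|]ger0_norm// ler_wpM2l.
have [wT wTlim] : exists wT, vlim T^'- w wT.
  apply: vlim_hom_ex => x; apply: vlim_hom_ex => y; have [l lP] := wlim x y.
  by exists l; apply/vlim_scalar.
have [gT gTlim] : exists gT, vlim T^'- g gT.
  apply: vlim_hom_ex => x; apply: vlim_hom_ex => y; have [l lP] := glim x y.
  by exists l; apply/vlim_scalar.
exists wT, gT; split=> //.
have app (B : R -> bilform R V) (BT : bilform R V) x y :
    vlim T^'- B BT -> vlim T^'- (fun t => B t x y) (BT x y).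
  by move=> BB; apply: vlim_app; exact: vlim_app.
have near_s : \forall t \near T^'-, s0 < t < T.
  near=> t; apply/andP; split; near: t; [exact: nbhs_left_gt|exact: nbhs_left_lt].
have nearH : \forall t \near T^'-, almost_hermitian (w t) (g t).
  by apply: filterS near_s => t /sub /flowP[].
have gTsym : Defs.symmetric_form gT.
  move=> x y; apply: vlim_uniq (app _ _ x y gTlim) _.
  apply: vlim_near (app _ _ y x gTlim).
  by apply: filterS nearH => t H; rewrite (ah_sym H).
have gTpos x : x != 0 -> (0 : R) < gT x x.
  move=> x0; have [H0 _ _] := flowP cs0T.
  have p0 : 0 < (g s0 x x : R) * expR (- (4 * M)).
    by rewrite mulr_gt0 ?expR_gt0 ?(ah_pos H0 x0).
  apply: lt_le_trans p0 _.
  have /(vlim_scalar _ _).1 gxx := app _ _ x x gTlim.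
  apply: (closed_cvg (fun z : R => (g s0 x x : R) * expR (- (4 * M)) <= z)) gxx.
    exact: closed_ge.
  by apply: filterS near_s => t /(gbd x)[].
have gTnd := pos_nondeg gTpos.
have wTalt : wT \in alt2 V R^o.
  apply/alt2P => x; apply: vlim_uniq (app _ _ x x wTlim) _.
  apply: (@vlim_near _ _ _ _ _ (fun=> 0)); last exact: vlim_cst.
  by apply: filterS nearH => t H; have /alt2P -> := ah_alt H.
(* Convergence of J needs nondegeneracy of [gT] alone, so it is available before the limit pair is
   known to be almost-hermitian. *)
have Jlim : vlim T^'- (fun t => Jop (w t) (g t)) (Jop wT gT).
  by apply: form_op_vlim => //; apply: filterS nearH => t; exact: ah_gnd.
have JJ : (Jop wT gT \o Jop wT gT)%VF = - \1%VF.
  have JJl : vlim T^'- (fun t => Jop (w t) (g t) \o Jop (w t) (g t))%VF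
    (Jop wT gT \o Jop wT gT)%VF by exact: vlim_comp.
  apply: vlim_uniq JJl _.
  apply: (@vlim_near _ _ _ _ _ (fun=> - \1%VF)); last exact: vlim_cst.
  by apply: filterS nearH => t H; rewrite (ah_J H).
split=> // x wx.
(* Nondegeneracy of [wT] comes last: its kernel lies in that of J, and J is invertible since its
   square is -1. *)
have Jx : Jop wT gT x = 0 by apply: (gTnd) => y; rewrite form_opE.
have /lfunP/(_ x) := JJ.
by rewrite comp_lfunE opp_lfunE id_lfunE Jx linear0 => /esym/eqP; rewrite oppr_eq0 => /eqP.
Unshelve. all: by end_near. Qed.

End Limit.

Lemma flow_vder (w g : R -> bilform R V) (a b : \bar R) t :
  flow_solution r mu w g a b -> eitv a b t ->
  exists wd gd : bilform R V, vder w t wd /\ vder g t gd.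
Proof.
move=> fl abt; have [H wd gd] := fl t abt.
exists (-2 *: rule_p r mu (w t) (g t)), (-2 *: rule_q r mu (w t) (g t)).
by split; apply: vder_hom => x; apply: vder_hom => y; apply/vder_scalar;
  rewrite !scale_lfunE; [exact: wd|exact: gd].
Qed.

(** The estimates are required only on ]c, T[, although the solution lives on ]a, T[; the theorem
    takes c = 0. *)
Lemma flow_extension (w g : R -> bilform R V) (a : \bar R) (c T M : R) (Phi al : R -> R) :
  (a <= c%:E)%E -> c < T -> flow_solution r mu w g a T%:E ->
  (forall t, c < t < T -> is_derive t (1 : R) Phi (al t) /\ `|Phi t| <= M) ->
  (forall t, c < t < T -> 0 <= al t) ->
  (forall t, c < t < T -> forall x,
    g t (vel (w t) (g t) x) (vel (w t) (g t) x) <= al t ^+ 2 * (g t x x : R)) ->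
  exists2 d : R, 0 < d & exists w' g' : R -> bilform R V,
    flow_solution r mu w' g' a (T + d)%:E /\
    forall t, eitv a T%:E t -> w' t = w t /\ g' t = g t.
Proof.
move=> ac cT fl PhiP al0 alP.
have flc : flow_solution r mu w g c%:E T%:E.
  by move=> t [ct tT]; apply: fl; split=> //; exact: le_lt_trans ct.
have [wT [gT [wlim glim HT]]] := flow_left_limit cT flc PhiP al0 alP.
have [d d0 [wn [gn [wnT gnT fln]]]] := flow_local hr dV hmu T HT.
exists d => //.
(* The strict test gives the restarted solution the value at T, which is the left limit of the given
   one; this makes the glued curve continuous there. *)
pose glue (u v : R -> bilform R V) t := if t < T then u t else v t.
pose w' := glue w wn; pose g' := glue g gn.
exists w', g'; split; last first.
  by move=> t [_]; rewrite lte_fin /w' /g' /glue => ->.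
have Tin : eitv (T - d)%:E (T + d)%:E T.
  by rewrite /eitv /= !lte_fin; split; lra.
have left_fl t : eitv a T%:E t -> forall (u v : R -> bilform R V) x y (D : R),
    is_derive t (1 : R) (fun s => u s x y : R) D ->
    is_derive t (1 : R) (fun s => glue u v s x y : R) D.
  move=> [_]; rewrite lte_fin => tT u v x y D; apply: near_eq_is_derive.
  have := lt_nbhsl tT; apply: filterS => s sT.
  by rewrite /glue sT.
have right_fl t : T < t -> forall (u v : R -> bilform R V) x y (D : R),
    is_derive t (1 : R) (fun s => v s x y : R) D ->
    is_derive t (1 : R) (fun s => glue u v s x y : R) D.
  move=> tT u v x y D; apply: near_eq_is_derive.
  have := lt_nbhsr tT; apply: filterS => s sT.
  by rewrite /glue ltNge (ltW sT).
have glue_lim (u v : R -> bilform R V) l : vlim T^'- u l -> vlim (nbhs T) v l ->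
    vlim (nbhs T) (glue u v) l.
  move=> ul vl; apply: norm_vlim => e e0.
  have vn : \forall s \near T, vnorm (v s - l) < e by exact: vlim_norm vl e0.
  have un : \forall s \near T, s < T -> vnorm (u s - l) < e by exact: vlim_norm ul e0.
  apply: filterS2 un vn => s us vs; rewrite /glue; case: ifPn => sT; apply: ltW => //.
  exact: us.
have [wnd [gnd [wnD gnD]]] := flow_vder fln Tin.
have w'lim : vlim (nbhs T) w' wT by apply: glue_lim => //; rewrite -wnT; exact: vder_vlim wnD.
have g'lim : vlim (nbhs T) g' gT by apply: glue_lim => //; rewrite -gnT; exact: vder_vlim gnD.
have w'T : w' T = wT by rewrite /w' /glue ltxx.
have g'T : g' T = gT by rewrite /g' /glue ltxx.
have away t : eitv a (T + d)%:E t -> t != T ->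
    [/\ almost_hermitian (w' t) (g' t),
        (forall x y, is_derive t (1 : R) (fun s => w' s x y : R)
          (- 2 * rule_p r mu (w' t) (g' t) x y : R)) &
        (forall x y, is_derive t (1 : R) (fun s => g' s x y : R)
          (- 2 * rule_q r mu (w' t) (g' t) x y : R))].
  move=> [at_ td] tn; have [tT|tT|/eqP] := ltgtP t T; last by rewrite (negPf tn).
    have ta : eitv a T%:E t by split; rewrite ?lte_fin.
    have [H wd gd] := fl t ta.
    have [-> ->] : w' t = w t /\ g' t = g t by rewrite /w' /g' /glue tT.
    split=> // x y.
      by apply: left_fl.
    by apply: left_fl.
  have tn' : eitv (T - d)%:E (T + d)%:E t.
    by split=> //; rewrite lte_fin; lra.
  have [H wd gd] := fln t tn'.
  have tT' : (t < T) = false by rewrite ltNge (ltW tT).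
  have [-> ->] : w' t = wn t /\ g' t = gn t by rewrite /w' /g' /glue tT'.
  split=> // x y.
    by apply: right_fl.
  by apply: right_fl.
move=> t tI; have [tT|/eqP tn] := pselect (t = T); last exact: away.
have aT : (a < T%:E)%E by rewrite (le_lt_trans ac)// lte_fin.
have near_in : \forall s \near T, eitv a (T + d)%:E s.
  have c1 := lt_nbhsr cT; have c2 : \forall s \near T, s < T + d.
    by apply: lt_nbhsl; lra.
  apply: filterS2 c1 c2 => s cs sd; split; rewrite ?lte_fin//.
  by rewrite (le_lt_trans ac)// lte_fin.
have near_H : \forall s \near T, almost_hermitian (w' s) (g' s).
  apply: filterS near_in => s sI; have [->|/eqP sn] := pselect (s = T).
    by rewrite w'T g'T.
  by have [] := away s sI sn.
(* Two-sided continuity of P and Q along the glued curve makes its right-hand side continuous at T,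
   as [is_derive_limit] demands. *)
have [Pl Ql] := rule_vlim hr dV hmu HT near_H w'lim g'lim.
have pE s x y : almost_hermitian (w' s) (g' s) ->
  rule_p r mu (w' s) (g' s) x y = w' s (Pop r mu (w' s) (g' s) x) y by move=> H; rewrite PopE.
have qE s x y : almost_hermitian (w' s) (g' s) ->
  rule_q r mu (w' s) (g' s) x y = g' s (Qop r mu (w' s) (g' s) x) y by move=> H; rewrite QopE.
have HT' : almost_hermitian (w' T) (g' T) by rewrite w'T g'T.
rewrite tT; split=> // x y.
- apply: (@is_derive_limit _ (fun s => w' s x y : R)
    (fun s => - 2 * rule_p r mu (w' s) (g' s) x y : R)).
  + have h1 : vlim (nbhs T) (fun s => w' s x y) (w' T x y).
      by rewrite w'T; apply: vlim_app; exact: vlim_app.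
    by have /(vlim_scalar _ _).1 := h1.
  + apply: cvgM; first exact: cvg_cst.
    have h1 : vlim (nbhs T) (fun s => rule_p r mu (w' s) (g' s) x y)
        (rule_p r mu (w' T) (g' T) x y).
      apply: (@vlim_near _ _ (nbhs T) _ _ (fun s => w' s (Pop r mu (w' s) (g' s) x) y)).
        by apply: filterS near_H => s Hs; rewrite pE.
      rewrite pE// w'T g'T; apply: vlim_app; apply: vlim_eval => //; exact: vlim_app.
    by have /(vlim_scalar _ _).1 := h1.
  + by apply: filterS near_in => s sI sn; have [] := away s sI sn.
- apply: (@is_derive_limit _ (fun s => g' s x y : R)
    (fun s => - 2 * rule_q r mu (w' s) (g' s) x y : R)).
  + have h1 : vlim (nbhs T) (fun s => g' s x y) (g' T x y).
      by rewrite g'T; apply: vlim_app; exact: vlim_app.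
    by have /(vlim_scalar _ _).1 := h1.
  + apply: cvgM; first exact: cvg_cst.
    have h1 : vlim (nbhs T) (fun s => rule_q r mu (w' s) (g' s) x y)
        (rule_q r mu (w' T) (g' T) x y).
      apply: (@vlim_near _ _ (nbhs T) _ _ (fun s => g' s (Qop r mu (w' s) (g' s) x) y)).
        by apply: filterS near_H => s Hs; rewrite qE.
      rewrite qE// w'T g'T; apply: vlim_app; apply: vlim_eval => //; exact: vlim_app.
    by have /(vlim_scalar _ _).1 := h1.
  + by apply: filterS near_in => s sI sn; have [] := away s sI sn.
Qed.

End Extension.

(** * Time reversal *)

Section TimeReversal.
Variable R : realType.

Definition opp_rule (r : pq_rule R) : pq_rule R :=
  PQRule (fun V mu w g => - rule_p r mu w g) (fun V mu w g => - rule_q r mu w g).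

Lemma Pop_opp r (V : vectType R) (mu : bimap V V) (w g : bilform R V) :
  Pop (opp_rule r) mu w g = - Pop r mu w g.
Proof. by rewrite /Pop /form_op comp_lfunNr. Qed.

Lemma Qop_opp r (V : vectType R) (mu : bimap V V) (w g : bilform R V) :
  Qop (opp_rule r) mu w g = - Qop r mu w g.
Proof. by rewrite /Qop /form_op comp_lfunNr. Qed.

Lemma cpart_opp (V : vectType R) (J A : 'End(V)) : cpart J (- A) = - cpart J A.
Proof. by rewrite /cpart comp_lfunNr comp_lfunNl -opprD scalerN. Qed.

Lemma acpart_opp (V : vectType R) (J A : 'End(V)) : acpart J (- A) = - acpart J A.
Proof. by rewrite /acpart comp_lfunNr comp_lfunNl -opprD scalerN. Qed.

Lemma vlip_opp (U W : vectType R) (f : U -> W) x0 : vlip f x0 -> vlip (fun x => - f x) x0.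
Proof.
move=> fl; rewrite (_ : (fun x => - f x) = fun x => (- \1%VF : 'End(W)) (f x)).
  exact: vlip_linl.
by apply/funext => x; rewrite opp_lfunE id_lfunE.
Qed.

Lemma lip_rule_opp n r : lip_rule n r -> lip_rule n (opp_rule r).
Proof.
case=> rt ri rc rr; split.
- move=> V mu w g dV lm H; have [pa qs] := rt V mu w g dV lm H; split.
    by rewrite rpredN.
  by move=> x y /=; rewrite !opp_lfunE qs.
- move=> V1 V2 mu1 mu2 w1 g1 w2 g2 phi d1 d2 l1 l2 H1 H2 bphi ml wE gE.
  have [PE QE] := ri V1 V2 mu1 mu2 w1 g1 w2 g2 phi d1 d2 l1 l2 H1 H2 bphi ml wE gE.
  by rewrite !Pop_opp !Qop_opp PE QE !comp_lfunNr !comp_lfunNl.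
- move=> V mu w g dV lm H.
  by rewrite Pop_opp Qop_opp !cpart_opp rc.
- move=> V w g mu dV H lm; have [FP [FQ [lP lQ PQ]]] := rr V w g mu dV H lm.
  exists (fun m => - FP m), (fun m => - FQ m).
  split; [exact: vlip_opp|exact: vlip_opp|].
  by move=> m hm; have [-> ->] := PQ m hm; rewrite Pop_opp Qop_opp.
Qed.

(** Relating [r] and [r'] by hypotheses, instead of taking [r'] to be [opp_rule r], allows the lemma
    to be applied in both directions. *)
Lemma flow_reverse (r r' : pq_rule R) (V : vectType R) (mu : bimap V V)
    (w g : R -> bilform R V) (a b : \bar R) :
  (forall w g, rule_p r' mu w g = - rule_p r mu w g) ->
  (forall w g, rule_q r' mu w g = - rule_q r mu w g) ->
  flow_solution r mu w g a b ->
  flow_solution r' mu (fun t => w (- t)) (fun t => g (- t)) (- b)%E (- a)%E.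
Proof.
move=> pE qE fl t [bt ta].
have nt : eitv a b (- t) by rewrite /eitv /= EFinN; split; [rewrite lteNr|rewrite lteNl].
have [H wd gd] := fl _ nt.
have dN : is_derive t (1 : R) (-%R : R -> R) (- 1 : R) by exact: is_deriveNid.
split=> // x y.
- have := @is_derive1_comp _ (fun s => w s x y : R) -%R t _ _ (wd x y) dN.
  by rewrite pE opp_lfunE opp_lfunE mulrN1 -mulrN.
- have := @is_derive1_comp _ (fun s => g s x y : R) -%R t _ _ (gd x y) dN.
  by rewrite qE opp_lfunE opp_lfunE mulrN1 -mulrN.
Qed.

Lemma eitv_nbhs (a b : \bar R) (t : R) : eitv a b t -> \forall s \near t, eitv a b s.
Proof.
move=> [at_ tb]; near=> s; split; near: s.
- case: a at_ => [a||]//; last by move=> _; near=> s; rewrite ltNyr.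
  by rewrite lte_fin => /lt_nbhsr; apply: filterS => s; rewrite lte_fin.
- case: b tb => [b||]//; first by rewrite lte_fin => /lt_nbhsl; apply: filterS => s; rewrite lte_fin.
  by move=> _; near=> s; rewrite ltry.
Unshelve. all: by end_near. Qed.

Lemma PQac_norm_continuous n r (hr : lip_rule n r) (V : vectType R) (mu : bimap V V)
    (w g : R -> bilform R V) (a b : \bar R) t :
  \dim {:V} = (2 * n)%N -> lie_bracket mu ->
  flow_solution r mu w g a b -> eitv a b t ->
  {for t, continuous (fun s => PQac_norm r mu (w s) (g s))}.
Proof.
move=> dV lm fl abt; have [wd [gd [wD gD]]] := flow_vder fl abt.
have [H _ _] := fl t abt.
apply: (PQac_norm_cvg hr dV lm H) => //.
- by apply: filterS (eitv_nbhs abt) => s /fl[].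
- exact: vder_vlim wD.
- exact: vder_vlim gD.
Qed.

Lemma PQac_norm_bound n r (hr : lip_rule n r) (V : vectType R) (mu : bimap V V)
    (w g : bilform R V) x : almost_hermitian w g ->
  let A := Pop r mu w g + acpart (Jop w g) (Qop r mu w g) in
  g (A x) (A x) <= PQac_norm r mu w g ^+ 2 * (g x x : R).
Proof. by move=> H; apply: op_norm_bound; [exact: ah_sym H|exact: ah_pos H]. Qed.

Lemma finite_integral_primitive n r (hr : lip_rule n r) (V : vectType R) (mu : bimap V V)
    (w g : R -> bilform R V) (a b : R) :
  \dim {:V} = (2 * n)%N -> lie_bracket mu -> flow_solution r mu w g a%:E b%:E ->
  (\int[lebesgue_measure]_(t in eitv a%:E b%:E) (PQac_norm r mu (w t) (g t))%:E != +oo)%E ->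
  exists (Phi : R -> R) (M : R), forall t, a < t < b ->
    is_derive t (1 : R) Phi (PQac_norm r mu (w t) (g t)) /\ `|Phi t| <= M.
Proof.
move=> dV lm fl fin.
have E : eitv a%:E b%:E = `]a, b[%classic.
  apply/seteqP; split=> t /=; rewrite /eitv /= !lte_fin in_itv /=.
    by move=> [-> ->].
  by move=> /andP[].
apply: (@integral_antiderivative _ (fun t => PQac_norm r mu (w t) (g t))).
- move=> t /andP[at_ tb]; apply: (PQac_norm_continuous hr dV lm fl).
  by rewrite /eitv /= !lte_fin.
- by move=> t _; exact: sqrtr_ge0.
- by rewrite -E ltey.
Qed.

End TimeReversal.

(** * Blow-up of the integral at either endpoint *)

Theorem theorem1p2 (R : realType) (n : nat) (r : pq_rule R)
  (hr : pq_standing n r)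
  (V : vectType R) (hV : \dim {:V} = (2 * n)%N)
  (mu : bimap V V) (hmu : lie_bracket mu)
  (w g : R -> bilform R V) (Tm Tp : \bar R)
  (hTm : (Tm < 0)%E) (hTp : (0 < Tp)%E)
  (hmax : maximal_flow_solution r mu w g Tm Tp) :
  ((Tp < +oo)%E ->
    (\int[lebesgue_measure]_(t in eitv 0%E Tp)
       (PQac_norm r mu (w t) (g t))%:E = +oo)%E) /\
  ((-oo < Tm)%E ->
    (\int[lebesgue_measure]_(t in eitv Tm 0%E)
       (PQac_norm r mu (w t) (g t))%:E = +oo)%E).
Proof.
have {}hr := standing_lip hr.
have [fl maxi] := hmax.
have sub (a b : \bar R) : (Tm <= a)%E -> (b <= Tp)%E -> flow_solution r mu w g a b.
  by move=> Ta bT t [at_ tb]; apply: fl; split; [exact: le_lt_trans at_|exact: lt_le_trans bT].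
split.
- case: Tp hTp hmax fl maxi sub => [T||]// T0 hmax fl maxi sub _.
  apply/eqP; apply: contraT => /(finite_integral_primitive hr hV hmu
    (sub 0%:E T%:E (ltW hTm) (lexx _)))[Phi [M PhiP]].
  rewrite lte_fin in T0.
  have [||d d0 [w' [g' [fl' ext]]]] := flow_extension hr hV hmu (ltW hTm) T0 fl PhiP.
  + by move=> t _; exact: sqrtr_ge0.
  + move=> t /andP[t0 tT] x; apply: (PQac_norm_bound hr).
    by have [] := fl t; first by split; [exact: lt_trans hTm _|rewrite lte_fin].
  have [] := maxi w' g' Tm (T + d)%:E (lexx _) _ fl' ext.
    by rewrite lee_fin lerDl ltW.
  by move=> _ [] /eqP; rewrite -subr_eq0 addrAC subrr add0r gt_eqF.
- case: Tm hTm hmax fl maxi sub => [T||]// T0 hmax fl maxi sub _.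
  apply/eqP; apply: contraT => /(finite_integral_primitive hr hV hmu
    (sub T%:E 0%:E (lexx _) (ltW hTp)))[Phi [M PhiP]].
  rewrite lte_fin in T0.
  have flN := @flow_reverse _ r (opp_rule r) V mu w g _ _ (fun _ _ => erefl) (fun _ _ => erefl) fl.
  have c0 : (- Tp <= 0%:E)%E by rewrite leeNl oppe0 ltW.
  have NT0 : 0 < - T by rewrite oppr_gt0.
  pose al t := PQac_norm r mu (w (- t)) (g (- t)).
  (* The outer sign and the one from the chain rule cancel, so - Phi(- s) is a primitive of the
     reversed norm. *)
  have PhiN t : 0 < t < - T -> is_derive t (1 : R) (fun s => - Phi (- s)) (al t) /\
      `|- Phi (- t)| <= M.
    move=> /andP[t0 tT]; have [|Pd PM] := PhiP (- t); first by apply/andP; split; lra.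
    split; last by rewrite normrN.
    have d1 := @is_derive1_comp _ Phi -%R t _ _ Pd (is_deriveNid t (1 : R)).
    by apply: (is_derive_eq (is_deriveN d1)); rewrite mulrN1 opprK.
  have [||d d0 [w' [g' [fl' ext]]]] :=
    flow_extension (lip_rule_opp hr) hV hmu c0 NT0 flN PhiN.
  + by move=> t _; exact: sqrtr_ge0.
  (* A changes sign under reversal but g(A x, A x) does not, so the bound for [r] carries over. *)
  + move=> t /andP[t0 tT] x; rewrite Pop_opp Qop_opp acpart_opp -opprD.
    rewrite opp_lfunE bilNl bilNr opprK; apply: (PQac_norm_bound hr).
    have [] := fl (- t) => //; split; rewrite ?lte_fin; first by lra.
    by apply: lt_trans hTp; rewrite lte_fin; lra.
  (* A second reversal returns to [r] and places the extension on the left, starting at T - d. *)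
  have fl'' : flow_solution r mu (fun t => w' (- t)) (fun t => g' (- t)) (- (- T + d)%:E)%E Tp.
    rewrite -[Tp]oppeK; apply: flow_reverse fl' => w1 g1; exact: esym (opprK _).
  have [||] := maxi _ _ _ _ _ (lexx Tp) fl''.
  + by rewrite -EFinN lee_fin; lra.
  + move=> t [Tt tTp]; have [|-> ->] := ext (- t); last by rewrite opprK.
    by split; [rewrite EFinN lteN2|rewrite lte_fin ltrN2 -lte_fin].
  + by rewrite -EFinN => -[] /eqP; rewrite opprD opprK -subr_eq0 addrAC subrr add0r oppr_eq0 gt_eqF.
Qed.
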